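(* Let $m,p\in\mathbb{N}$ with $p\ge 2$. Suppose that $f=h+\overline{g}$ is a harmonic $p$-symmetric function in $\mathbb{D}$, where $h(z)=\sum_{k=0}^{\infty}a_kz^{pk+m}$ and $g(z)=\sum_{k=0}^{\infty}b_kz^{pk+m}$ are analytic in $\mathbb{D}$, such that $|h^{(m)}(0)|=|g^{(m)}(0)|$, $|g'(z)|\le d|h'(z)|$ in $\mathbb{D}\setminus\{0\}$ for some $d\in[0,1]$, and $h$ is bounded. Put $B_H(f,r)=\sum_{k=0}^{\infty}(|a_k|+|b_k|)r^{pk+m}$. Then the following hold. (1) If $\frac{p}{m}>\log_2(2+d)$, then $B_H(f,r)\le\|h\|_\infty$ for $0\le r\le\sqrt[m]{1/2}$. When $d=1$, the mapping $f(z)=h(z)+\overline{\lambda h(z)}$ with $h(z)=z^m$ and $|\lambda|=1$ is extremal. (2) If $1\le\frac{p}{m}\le\log_2(2+d)$, then $B_H(f,r)\le\|h\|_\infty$ for $0\le r\le r_{p,m,d}$, where $r_{p,m,d}$ is the maximal positive root of the equation $$r^{2(p-m)}-(8+4d)r^{p-m}+4(1+d)(3+d)r^{2p}+4=0.$$ When $d=1$, the mapping $f(z)=h(z)+\overline{\lambda h(z)}$, $|\lambda|=1$, is extremal, where $$h(z)=z^m\left(\frac{z^p-a}{1-az^p}\right)\quad\text{with}\quad a=\left(1-\frac{\sqrt{1-r_{p,m,1}^{2p}}}{\sqrt2}\right)\frac{1}{r_{p,m,1}^{p}}.$$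
   Context: $\mathbb{D}=\{z\in\mathbb{C}:|z|<1\}$, $\mathbb N=\{1,2,\dots\}$, and $\|h\|_\infty=\sup_{z\in\mathbb{D}}|h(z)|$. A harmonic function $f=h+\overline{g}$ in $\mathbb{D}$ ($h,g$ analytic) is called $p$-symmetric if $h$ and $g$ have power series of the form $\sum_{n\ge0}a_nz^{pn+m}$ and $\sum_{n\ge0}b_nz^{pn+m}$ for some nonnegative integer $m$. ''Extremal'' means that the stated radius is attained and cannot be enlarged because of this $f$: $B_H(f,r)=\|h\|_\infty$ when $r$ equals the stated radius, and $B_H(f,r)>\|h\|_\infty$ for larger $r\in(0,1)$. *)

(* Defs.v *)
(* Stdlib world: concrete reals and Coquelicot's complex numbers. *)
From Stdlib Require Import Reals.
From Coquelicot Require Import Coquelicot.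
Open Scope R_scope.

Definition in_disc (z : C) : Prop := Cmod z < 1.

(* Complex differentiability at every point of the disc. *)
Definition analytic_in_disc (h : C -> C) : Prop :=
  forall z : C, in_disc z -> @ex_derive C_AbsRing C_NormedModule h z.

(* Coquelicot's [C_derive] is total; it is the complex derivative wherever
   that derivative exists, which is the only place where it is used below. *)
Definition C_derive_n (h : C -> C) (n : nat) : C -> C := Nat.iter n C_derive h.

(* The supremum is taken in the extended reals, so it is meaningful whether or
   not [h] is bounded. *)
Definition sup_norm (h : C -> C) : Rbar :=
  Lub_Rbar (fun x : R => exists z : C, in_disc z /\ x = Cmod (h z)).

Definition bounded_in_disc (h : C -> C) : Prop :=
  exists M : R, forall z : C, in_disc z -> Cmod (h z) <= M.

Definition has_expansion (p m : nat) (a : nat -> C) (h : C -> C) : Prop :=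
  forall z : C, in_disc z ->
    @is_series C_AbsRing C_NormedModule
      (fun k : nat => (a k * z ^ (p * k + m))%C) (h z).

(* [f = h + conj g] is harmonic and p-symmetric in the disc, with starting
   exponent [m] and coefficient sequences [a] (for [h]) and [b] (for [g]). *)
Definition harmonic_p_symmetric (p m : nat) (a b : nat -> C) (f h g : C -> C)
  : Prop :=
  (forall z : C, in_disc z -> f z = (h z + Cconj (g z))%C) /\
  analytic_in_disc h /\ analytic_in_disc g /\
  has_expansion p m a h /\ has_expansion p m b g.

Definition admissible (p m : nat) (d : R) (a b : nat -> C) (f h g : C -> C)
  : Prop :=
  harmonic_p_symmetric p m a b f h g /\
  Cmod (C_derive_n h m 0) = Cmod (C_derive_n g m 0) /\
  (forall z : C, in_disc z -> z <> 0 ->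
     Cmod (C_derive g z) <= d * Cmod (C_derive h z)) /\
  bounded_in_disc h.

(* The majorant series.  Its terms are nonnegative for [0 <= r], so the partial
   sums converge in the extended reals, with value [p_infty] on divergence. *)
Definition B_H (p m : nat) (a b : nat -> C) (r : R) : Rbar :=
  Lim_seq (sum_n (fun k : nat => (Cmod (a k) + Cmod (b k)) * r ^ (p * k + m))).

(* [f] belongs to the class, the bound is attained at the radius [R0], and it
   fails at every larger radius below 1.  The sequences [a] and [b] are
   determined by [h] and [g] (uniqueness of power series coefficients). *)
Definition extremal (p m : nat) (d : R) (f h g : C -> C) (R0 : R) : Prop :=
  exists a b : nat -> C,
    admissible p m d a b f h g /\
    B_H p m a b R0 = sup_norm h /\
    (forall r : R, R0 < r -> 0 < r < 1 -> Rbar_lt (sup_norm h) (B_H p m a b r)).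

(* Used only with [m <= p], so the truncated subtraction is the genuine one. *)
Definition radius_eqn (p m : nat) (d r : R) : Prop :=
  r ^ (2 * (p - m)) - (8 + 4 * d) * r ^ (p - m)
    + 4 * (1 + d) * (3 + d) * r ^ (2 * p) + 4 = 0.

Definition is_max_pos_root (p m : nat) (d r0 : R) : Prop :=
  0 < r0 /\ radius_eqn p m d r0 /\
  (forall r : R, 0 < r -> radius_eqn p m d r -> r <= r0).

Definition extremal_a (p : nat) (r : R) : R :=
  (1 - sqrt (1 - r ^ (2 * p)) / sqrt 2) * (1 / r ^ p).

(* Main.v *)
(* Write h(z) = z^m phi(z^p) and normalize |h| <= 1.  Testing h, as a
   multiplication operator on the Hardy space, against alpha + beta z^(p L)
   gives |a_L|^2 <= (1 - |a_0|^2) (1 - sum_(l < L) |a_l|^2), whence, by Abel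
   summation, sum_(k >= 1) |a_k|^2 rho^k <= rho (1 - |a_0|^2)^2 / (1 - |a_0|^2 rho)
   for rho <= 1.  Parseval turns |g'| <= d |h'| into an inequality between power
   series in |z|; dividing twice by the exponent (an integration) and using
   |a_0| = |b_0| gives the same bound for b, multiplied by d^2.  Cauchy-Schwarz
   with the best rho then bounds the majorant series, with s = r^p, by
   r^m (2 t + (1 + d) s (1 - t^2) / (1 - t s)) where t = max (|a_0|, s), and at
   the stated radius this is at most 1 for all t in [s, 1]: the radius equation
   says that its maximum over t equals 1.  For the
   extremal functions the majorant series equals 1 at the radius and |h| <= 1,
   so the inequality just proved forces the supremum norm to be 1. *)

Require Import Defs.
From Stdlib Require Import Reals Factorial Lra Lia.
From Coquelicot Require Import Coquelicot.
Open Scope R_scope.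

(** * Finite sums and series *)

(* [sum_n] types its values by structure projections, which hide the field
   from [ring]. *)
Ltac C_ring := match goal with |- @eq _ ?x ?y => change (@eq C x y) end; ring.
Ltac R_ring := match goal with |- @eq _ ?x ?y => change (@eq R x y) end; ring.

(** No integral over a circle is taken: Parseval is an average over [n + 1] sample points, placed so
    that [z ^ p] runs through roots of unity, and infinite sums are compared through partial sums up
    to an arbitrary [eps]. The dilatation condition compares whole power series and not single
    coefficients; therefore square sums with a free weight [rho] are bounded, and [rho] is chosen
    last. The best choice is [s / |a_0|], which is at most 1 exactly when [|a_0| >= s]; this is the
    origin of [max (|a_0|, s)]. Nothing is lost for [|a_0| >= s]: every estimate for [h] is an
    equality for a Blaschke factor in [z ^ p]. The quantity [2 t + (1 + d) s (1 - t^2) / (1 - t s)]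
    has nonnegative slope at [t = 1] exactly when [s <= 1 / (2 + d)]. Then its maximum is at [t = 1]
    and only [2 r^m <= 1] remains, which is case (1). Otherwise, with [tau = 1 - t s], it is, up to
    the factor [s], a constant minus [A tau + B / tau]. The radius equation is the squared equality
    case of the inequality between arithmetic and geometric means, and for [d = 1] the optimal [tau]
    yields the constant [a] of the Blaschke factor. *)

Lemma is_series_C_iff (u : nat -> C) (l : C) :
  @is_series C_AbsRing C_NormedModule u l <->
  forall eps, 0 < eps -> exists N, forall n, (N <= n)%nat ->
    Cmod (sum_n u n - l) < eps.
Proof.
  split.
  - intros H eps He.
    destruct (proj1 (filterlim_locally_ball_norm _ _) H (mkposreal eps He))
      as [N HN].
    exists N; intros n Hn; exact (HN n Hn).
  - intros H. apply (proj2 (filterlim_locally_ball_norm _ _)).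
    intros eps. destruct (H eps (cond_pos eps)) as [N HN].
    exists N; intros n Hn; exact (HN n Hn).
Qed.

Lemma is_series_C_unique (u : nat -> C) (l l' : C) :
  @is_series C_AbsRing C_NormedModule u l ->
  @is_series C_AbsRing C_NormedModule u l' -> l = l'.
Proof.
  intros H H'.
  exact (filterlim_locally_unique _ _ _ H H').
Qed.

Lemma sum_n_S (u : nat -> R) (n : nat) : sum_n u (S n) = sum_n u n + u (S n).
Proof. exact (sum_Sn u n). Qed.

Lemma sum_n_CS (u : nat -> C) (n : nat) :
  sum_n u (S n) = (sum_n u n + u (S n))%C.
Proof. exact (sum_Sn u n). Qed.

Lemma sum_n_le_loc (u v : nat -> R) (n : nat) :
  (forall k, (k <= n)%nat -> u k <= v k) -> sum_n u n <= sum_n v n.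
Proof.
  induction n as [|n IH]; intros H.
  - rewrite !sum_O; apply H; lia.
  - rewrite !sum_n_S. apply Rplus_le_compat; [apply IH; intros; apply H; lia|].
    apply H; lia.
Qed.

Lemma sum_n_nonneg (u : nat -> R) (n : nat) :
  (forall k, (k <= n)%nat -> 0 <= u k) -> 0 <= sum_n u n.
Proof.
  intros H. replace 0 with (sum_n (fun _ : nat => 0) n).
  - apply sum_n_le_loc; exact H.
  - rewrite sum_n_const; apply Rmult_0_r.
Qed.

Lemma sum_n_scal (c : R) (u : nat -> R) (n : nat) :
  sum_n (fun k => c * u k) n = c * sum_n u n.
Proof. exact (sum_n_mult_l c u n). Qed.

Lemma sum_n_Cscal (c : C) (u : nat -> C) (n : nat) :
  sum_n (fun k => (c * u k)%C) n = (c * sum_n u n)%C.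
Proof. exact (sum_n_mult_l (K := C_Ring) c u n). Qed.

Lemma sum_n_add (u v : nat -> R) (n : nat) :
  sum_n (fun k => u k + v k) n = sum_n u n + sum_n v n.
Proof. exact (sum_n_plus u v n). Qed.

Lemma sum_n_Cadd (u v : nat -> C) (n : nat) :
  sum_n (fun k => (u k + v k)%C) n = (sum_n u n + sum_n v n)%C.
Proof. exact (sum_n_plus u v n). Qed.

Lemma Cmod_sum_n (u : nat -> C) (n : nat) :
  Cmod (sum_n u n) <= sum_n (fun k => Cmod (u k)) n.
Proof.
  induction n as [|n IH].
  - rewrite !sum_O; lra.
  - rewrite sum_n_CS, sum_n_S.
    eapply Rle_trans; [apply Cmod_triangle|]; lra.
Qed.

Lemma sum_n_le_series (u : nat -> R) (s : R) :
  (forall k, 0 <= u k) -> is_series u s -> forall n, sum_n u n <= s.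
Proof.
  intros Hu Hs n.
  apply (is_lim_seq_incr_compare (sum_n u) s).
  - exact Hs.
  - intros k; rewrite sum_n_S; specialize (Hu (S k)); lra.
Qed.

(** Differences of partial sums are dominated by those of the majorant, and this passes to the
    limit. When the majorant depends only on the modulus of the variable, the estimate is uniform on
    a circle. *)
Lemma is_series_C_tail (u : nat -> C) (v : nat -> R) (l : C) (s : R) :
  @is_series C_AbsRing C_NormedModule u l -> is_series v s ->
  (forall k, Cmod (u k) <= v k) ->
  forall n, Cmod (l - sum_n u n) <= s - sum_n v n.
Proof.
  intros Hu Hv Huv n.
  assert (Hdiff : forall i,
    Cmod (sum_n u (n + i) - sum_n u n) <= sum_n v (n + i) - sum_n v n).
  { induction i as [|i IH].
    - rewrite Nat.add_0_r. replace (sum_n u n - sum_n u n)%C with (RtoC 0) by ring.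
      rewrite Cmod_0; lra.
    - rewrite <- plus_n_Sm, sum_n_CS, sum_n_S.
      replace (sum_n u (n + i) + u (S (n + i)) - sum_n u n)%C
        with ((sum_n u (n + i) - sum_n u n) + u (S (n + i)))%C by ring.
      eapply Rle_trans; [apply Cmod_triangle|].
      specialize (Huv (S (n + i))); lra. }
  apply le_epsilon; intros eps Heps.
  destruct (proj1 (is_series_C_iff u l) Hu eps Heps) as [N HN].
  specialize (HN (n + N)%nat ltac:(lia)). specialize (Hdiff N).
  assert (Hs : sum_n v (n + N) <= s).
  { apply sum_n_le_series; [|exact Hv].
    intros k; eapply Rle_trans; [apply Cmod_ge_0|apply Huv]. }
  replace (l - sum_n u n)%C
    with (- (sum_n u (n + N) - l) + (sum_n u (n + N) - sum_n u n))%C by ring.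
  eapply Rle_trans; [apply Cmod_triangle|]. rewrite Cmod_opp; lra.
Qed.

Lemma ex_series_le_R (u v : nat -> R) :
  (forall k, 0 <= u k <= v k) -> ex_series v -> ex_series u.
Proof.
  intros H Hv. apply (ex_series_le (V := R_CompleteNormedModule) u v); [|exact Hv].
  intros k. change (norm (u k)) with (Rabs (u k)).
  rewrite Rabs_pos_eq; apply H.
Qed.

Lemma ex_series_scal_R (c : R) (u : nat -> R) :
  ex_series u -> ex_series (fun k => c * u k).
Proof. exact (ex_series_scal (V := R_NormedModule) c u). Qed.

Lemma pow_le_one (r : R) (n : nat) : 0 <= r <= 1 -> 0 <= r ^ n <= 1.
Proof.
  intros H; split; [apply pow_le; lra|].
  rewrite <- (pow1 n). apply pow_incr; lra.
Qed.

Lemma pow_anti (r : R) (m n : nat) : 0 <= r <= 1 -> (m <= n)%nat -> r ^ n <= r ^ m.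
Proof.
  intros H Hmn. replace n with (m + (n - m))%nat by lia. rewrite pow_add.
  pose proof (pow_le_one r m H). pose proof (pow_le_one r (n - m) H). nra.
Qed.

(** Half of the decay of [r ^ n] pays for the factor [n]: with [q = sqrt r], the product [n q^n]
    stays bounded and another [q^n] is left over. *)
Lemma INR_mul_pow_bounded (r : R) :
  0 <= r < 1 -> exists K, 0 <= K /\ forall n, INR n * r ^ n <= K * sqrt r ^ n.
Proof.
  intros Hr.
  assert (Hq : 0 <= sqrt r < 1).
  { split; [apply sqrt_pos|]. rewrite <- sqrt_1. apply sqrt_lt_1; lra. }
  set (q := sqrt r) in *.
  assert (Hqq : r = q * q) by (unfold q; rewrite sqrt_sqrt; lra).
  exists (/ (1 - q)). split; [left; apply Rinv_0_lt_compat; lra|].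
  assert (Hb : forall n, INR n * q ^ n <= / (1 - q)).
  { intros n.
    (* [n q^n <= 1 + q + ... + q^(n-1)], a partial sum of the geometric series *)
    assert (Hg : INR n * q ^ n * (1 - q) <= 1 - q ^ n).
    { induction n as [|n IH]; [simpl; lra|].
      rewrite S_INR; simpl.
      pose proof (pow_le_one q n ltac:(lra)) as HQ.
      pose proof (Rmult_le_compat_l q _ _ (proj1 Hq) IH).
      pose proof (Rmult_le_pos (1 - q) (1 - q * q ^ n) ltac:(lra) ltac:(nra)).
      nra. }
    apply (Rmult_le_reg_r (1 - q)); [lra|]. rewrite Rinv_l by lra.
    pose proof (pow_le_one q n ltac:(lra)). lra. }
  intros n. rewrite Hqq, Rpow_mult_distr.
  pose proof (pow_le_one q n ltac:(lra)). specialize (Hb n). nra.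
Qed.

(** * Termwise differentiation of power series *)

Definition abs_summable (p m : nat) (a : nat -> C) : Prop :=
  forall r, 0 <= r < 1 -> ex_series (fun k => Cmod (a k) * r ^ (p * k + m)).

(** Abel's argument: convergence at a real point [t] between [r] and 1 bounds the terms there, and
    passing to radius [r] gains a geometric factor [r / t]. *)
Lemma has_expansion_abs_summable (p m : nat) (a : nat -> C) (h : C -> C) :
  (1 <= p)%nat -> has_expansion p m a h -> abs_summable p m a.
Proof.
  intros Hp H r Hr.
  set (t := (1 + r) / 2).
  assert (Ht : 0 < t < 1 /\ r <= t) by (unfold t; lra).
  specialize (H (RtoC t)).
  assert (Hd : in_disc (RtoC t)).
  { unfold in_disc; rewrite Cmod_R, Rabs_pos_eq; lra. }
  specialize (H Hd).
  destruct (proj1 (is_series_C_iff _ _) H 1 Rlt_0_1) as [N HN].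
  set (w := fun k => (a k * RtoC t ^ (p * k + m))%C) in *.
  assert (Hw : forall k, Cmod (w k) = Cmod (a k) * t ^ (p * k + m)).
  { intros k; unfold w. rewrite Cmod_mult, Cmod_pow, Cmod_R, Rabs_pos_eq; lra. }
  assert (HwN : forall k, (N < k)%nat -> Cmod (w k) <= 2).
  { intros [|k] Hk; [lia|].
    pose proof (HN k ltac:(lia)) as H1. pose proof (HN (S k) ltac:(lia)) as H2.
    rewrite sum_n_CS in H2.
    replace (w (S k)) with ((sum_n w k + w (S k) - h t) + - (sum_n w k - h t))%C by ring.
    eapply Rle_trans; [apply Cmod_triangle|]. rewrite Cmod_opp; lra. }
  assert (Hb : exists B, 0 <= B /\ forall k, Cmod (w k) <= B).
  { exists (2 + sum_n (fun k => Cmod (w k)) N).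
    assert (Hs : 0 <= sum_n (fun k => Cmod (w k)) N)
      by (apply sum_n_nonneg; intros; apply Cmod_ge_0).
    split; [lra|]. intros k.
    destruct (Nat.le_gt_cases k N) as [Hk|Hk]; [|specialize (HwN k Hk); lra].
    enough (Cmod (w k) <= sum_n (fun k => Cmod (w k)) N) by lra.
    clear -Hk. induction N as [|N IH].
    - replace k with 0%nat by lia. rewrite sum_O; lra.
    - rewrite sum_n_S. destruct (Nat.eq_dec k (S N)) as [->|Hne].
      + enough (0 <= sum_n (fun k => Cmod (w k)) N) by lra.
        apply sum_n_nonneg; intros; apply Cmod_ge_0.
      + pose proof (Cmod_ge_0 (w (S N))). specialize (IH ltac:(lia)). lra. }
  destruct Hb as [B [HB0 HB]].
  assert (Hq : 0 <= r / t < 1).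
  { split; [apply Rdiv_le_0_compat; lra|].
    apply (Rmult_lt_reg_r t); [lra|]. field_simplify; unfold t; lra. }
  apply (ex_series_le_R _ (fun k => B * (r / t) ^ k)).
  - intros k. split.
    + apply Rmult_le_pos; [apply Cmod_ge_0|apply pow_le; lra].
    + replace (r ^ (p * k + m)) with (t ^ (p * k + m) * (r / t) ^ (p * k + m)).
      2:{ rewrite <- Rpow_mult_distr. f_equal. field; lra. }
      rewrite <- Rmult_assoc, <- Hw.
      apply Rmult_le_compat; [apply Cmod_ge_0|apply pow_le; lra|apply HB|].
      (* As [p >= 1], the exponent [p k + m] is at least [k]. *)
      apply pow_anti; [lra|nia].
  - apply ex_series_scal_R.
    apply ex_series_geom. rewrite Rabs_pos_eq; lra.
Qed.

(** The factor [p k + m] is absorbed by moving from radius [r] to [sqrt r], which is still below 1;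
    hence the lemma can be iterated. *)
Lemma abs_summable_mul (p m : nat) (a : nat -> C) :
  abs_summable p m a -> abs_summable p m (fun k => (INR (p * k + m) * a k)%C).
Proof.
  intros H r Hr.
  destruct (INR_mul_pow_bounded r Hr) as [K [HK0 HK]].
  assert (Hq : 0 <= sqrt r < 1).
  { split; [apply sqrt_pos|]. rewrite <- sqrt_1. apply sqrt_lt_1; lra. }
  apply (ex_series_le_R _ (fun k => K * (Cmod (a k) * sqrt r ^ (p * k + m)))).
  - intros k. rewrite Cmod_mult, Cmod_R, (Rabs_pos_eq _ (pos_INR _)).
    pose proof (Cmod_ge_0 (a k)). pose proof (pos_INR (p * k + m)).
    split.
    + repeat apply Rmult_le_pos; try assumption. apply pow_le; lra.
    + specialize (HK (p * k + m)%nat). nra.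
  - apply ex_series_scal_R. exact (H _ Hq).
Qed.

(* Second-order Taylor estimate for monomials, scaled by [rho ^ 2] to avoid
   the exponent [n - 2]. *)
Lemma Cpow_taylor (n : nat) (rho : R) (z w : C) :
  Cmod z <= rho -> Cmod w <= rho -> rho <= 1 ->
  Cmod (w ^ n - z ^ n - INR n * z ^ pred n * (w - z)) * rho ^ 2
    <= INR n ^ 2 * rho ^ n * Cmod (w - z) ^ 2.
Proof.
  intros Hz Hw Hrho.
  assert (Hr0 : 0 <= rho) by (eapply Rle_trans; [apply Cmod_ge_0|exact Hz]).
  induction n as [|[|n] IH].
  - simpl. replace (1 - 1 - 0 * 1 * (w - z))%C with (RtoC 0) by ring.
    rewrite Cmod_0; lra.
  - simpl. replace (w * 1 - z * 1 - 1 * 1 * (w - z))%C with (RtoC 0) by ring.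
    rewrite Cmod_0. pose proof (Cmod_ge_0 (w - z)). nra.
  - set (m := S n) in *.
    (* The remainder of degree [m + 1] is [w] times the one of degree [m], plus
       [m z^(m-1) (w - z)^2]; the constants fit because [m^2 + m <= (m + 1)^2]. *)
    replace (w ^ S m - z ^ S m - INR (S m) * z ^ pred (S m) * (w - z))%C
      with (w * (w ^ m - z ^ m - INR m * z ^ pred m * (w - z))
            + INR m * z ^ pred m * ((w - z) * (w - z)))%C.
    2:{ rewrite (S_INR m), RtoC_plus. change (pred (S m)) with m.
        assert (Hzm : (z ^ m)%C = (z * z ^ pred m)%C) by reflexivity.
        rewrite !(Cpow_S _ m), Hzm. ring. }
    eapply Rle_trans.
    { apply Rmult_le_compat_r; [apply pow2_ge_0|apply Cmod_triangle]. }
    rewrite !Cmod_mult, Cmod_R, (Rabs_pos_eq _ (pos_INR m)), Cmod_pow.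
    set (E := Cmod (w ^ m - z ^ m - INR m * z ^ pred m * (w - z))) in *.
    set (D := Cmod (w - z)) in *.
    assert (HE : 0 <= E) by apply Cmod_ge_0.
    assert (HD : 0 <= D) by apply Cmod_ge_0.
    assert (Hm : 1 <= INR m) by (apply (le_INR 1); unfold m; lia).
    assert (Hzp : 0 <= Cmod z ^ pred m <= rho ^ pred m).
    { split; [apply pow_le, Cmod_ge_0|].
      apply pow_incr; split; [apply Cmod_ge_0|exact Hz]. }
    assert (H1 : Cmod w * E * rho ^ 2 <= rho * (INR m ^ 2 * rho ^ m * D ^ 2)).
    { rewrite Rmult_assoc. apply Rmult_le_compat; try assumption.
      - apply Cmod_ge_0.
      - apply Rmult_le_pos; [assumption|apply pow2_ge_0]. }
    assert (H2 : INR m * Cmod z ^ pred m * (D * D) * rho ^ 2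
                 <= INR m * rho ^ S m * D ^ 2).
    { replace (rho ^ S m) with (rho ^ pred m * rho ^ 2).
      2:{ rewrite <- pow_add. f_equal. unfold m; lia. }
      replace (INR m * (rho ^ pred m * rho ^ 2) * D ^ 2)
        with (INR m * rho ^ pred m * (D * D) * rho ^ 2) by ring.
      apply Rmult_le_compat_r; [apply pow2_ge_0|].
      apply Rmult_le_compat_r; [nra|].
      apply Rmult_le_compat_l; lra. }
    rewrite S_INR. change (rho ^ S m) with (rho * rho ^ m) in *.
    assert (0 <= rho * rho ^ m * D ^ 2).
    { apply Rmult_le_pos; [|apply pow2_ge_0].
      apply Rmult_le_pos; [lra|apply pow_le; lra]. }
    rewrite Rmult_plus_distr_r. nra.
Qed.

Lemma is_derive_C_quadratic (f : C -> C) (z l : C) (delta K : R) :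
  0 < delta -> 0 <= K ->
  (forall w, Cmod (w - z) < delta ->
     Cmod (f w - f z - l * (w - z)) <= K * Cmod (w - z) ^ 2) ->
  @is_derive C_AbsRing C_NormedModule f z l.
Proof.
  intros Hd HK H. split.
  - apply is_linear_scal_l.
  - intros x Hx.
    assert (Hxz := is_filter_lim_locally_unique (V := AbsRing_NormedModule C_AbsRing) _ _ Hx). subst x.
    intros eps.
    (* [K + 1] instead of [K] keeps the denominator positive when [K = 0]. *)
    assert (He : 0 < Rmin delta (eps / (K + 1))).
    { apply Rmin_pos; [exact Hd|]. apply Rdiv_lt_0_compat; [apply eps|lra]. }
    apply (filter_imp (fun w => Cmod (w - z) < Rmin delta (eps / (K + 1)))).
    + intros w Hw.
      change (Cmod (f w - f z - (w - z) * l)%C <= eps * Cmod (w - z)).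
      replace ((w - z) * l)%C with (l * (w - z))%C by ring.
      pose proof (Rmin_l delta (eps / (K + 1))).
      pose proof (Rmin_r delta (eps / (K + 1))).
      pose proof (Cmod_ge_0 (w - z)).
      eapply Rle_trans; [apply H; lra|].
      assert (Hc : Cmod (w - z) * (K + 1) <= eps).
      { replace (pos eps) with (eps / (K + 1) * (K + 1)) by (field; lra).
        apply Rmult_le_compat_r; lra. }
      nra.
    + exact (locally_ball_norm (V := AbsRing_NormedModule C_AbsRing) z (mkposreal _ He)).
Qed.

Lemma is_series_C_norm (u : nat -> C) (v : nat -> R) (l : C) (s : R) :
  @is_series C_AbsRing C_NormedModule u l -> is_series v s ->
  (forall k, Cmod (u k) <= v k) -> Cmod l <= s.
Proof.
  intros Hu Hv Huv.
  pose proof (is_series_C_tail u v l s Hu Hv Huv 0) as H.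
  rewrite !sum_O in H.
  replace l with ((l - u 0%nat) + u 0%nat)%C by ring.
  eapply Rle_trans; [apply Cmod_triangle|]. specialize (Huv 0%nat). lra.
Qed.

Lemma is_series_C_scal (c : C) (u : nat -> C) (l : C) :
  @is_series C_AbsRing C_NormedModule u l ->
  @is_series C_AbsRing C_NormedModule (fun k => (c * u k)%C) (c * l)%C.
Proof. exact (is_series_scal (V := C_NormedModule) c u l). Qed.

Lemma is_series_C_plus (u v : nat -> C) (l l' : C) :
  @is_series C_AbsRing C_NormedModule u l ->
  @is_series C_AbsRing C_NormedModule v l' ->
  @is_series C_AbsRing C_NormedModule (fun k => (u k + v k)%C) (l + l')%C.
Proof. exact (is_series_plus (V := C_NormedModule) u v l l'). Qed.

Lemma ex_series_C_abs (u : nat -> C) :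
  ex_series (fun k => Cmod (u k)) ->
  exists l, @is_series C_AbsRing C_NormedModule u l.
Proof.
  intros H. apply (ex_series_le (V := C_CompleteNormedModule) u (fun k => Cmod (u k))).
  - intros k. apply Rle_refl.
  - exact H.
Qed.

(** The Taylor remainders of the monomials are summed on a disc of radius [rho] strictly between
    [Cmod z] and 1. Their sum is controlled by the series of [e^2 |a_k| rho^e] with
    [e = p k + m + 1], so two applications of [abs_summable_mul] are made. Starting at [S m] leaves
    the derivative with the natural exponents [p k + m]. *)
Lemma has_expansion_is_derive (p m : nat) (a : nat -> C) (h : C -> C) (z : C) :
  (1 <= p)%nat -> has_expansion p (S m) a h -> in_disc z ->
  exists D,
    @is_series C_AbsRing C_NormedModule
      (fun k => (INR (p * k + S m) * a k * z ^ (p * k + m))%C) D /\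
    @is_derive C_AbsRing C_NormedModule h z D.
Proof.
  intros Hp H Hz.
  pose proof (has_expansion_abs_summable _ _ _ _ Hp H) as Ha.
  pose proof (abs_summable_mul _ _ _ Ha) as Ha1.
  pose proof (abs_summable_mul _ _ _ Ha1) as Ha2.
  unfold in_disc in Hz. pose proof (Cmod_ge_0 z) as Hz0.
  set (rho := (1 + Cmod z) / 2).
  assert (Hrho : 0 < rho < 1 /\ Cmod z < rho) by (unfold rho; lra).
  assert (HD : exists D, @is_series C_AbsRing C_NormedModule
      (fun k => (INR (p * k + S m) * a k * z ^ (p * k + m))%C) D).
  { apply ex_series_C_abs.
    apply (ex_series_le_R _ (fun k => / rho *
      (Cmod (INR (p * k + S m) * a k) * rho ^ (p * k + S m)))).
    - intros k. rewrite !Cmod_mult, Cmod_pow. split.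
      + repeat apply Rmult_le_pos; try apply Cmod_ge_0. apply pow_le, Cmod_ge_0.
      + replace (rho ^ (p * k + S m)) with (rho * rho ^ (p * k + m)).
        2:{ rewrite <- plus_n_Sm; reflexivity. }
        set (X := Cmod (INR (p * k + S m)) * Cmod (a k)).
        replace (/ rho * (X * (rho * rho ^ (p * k + m))))
          with (X * rho ^ (p * k + m)) by (field; lra).
        apply Rmult_le_compat_l.
        * apply Rmult_le_pos; apply Cmod_ge_0.
        * apply pow_incr; lra.
    - apply ex_series_scal_R, Ha1; lra. }
  destruct HD as [D HD]. exists D. split; [exact HD|].
  destruct (Ha2 rho ltac:(lra)) as [K HK].
  assert (HK0 : 0 <= K).
  { set (v := fun k => Cmod (INR (p * k + S m) * (INR (p * k + S m) * a k))
                         * rho ^ (p * k + S m)) in HK.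
    assert (Hv : forall k, 0 <= v k)
      by (intros k; apply Rmult_le_pos; [apply Cmod_ge_0|apply pow_le; lra]).
    eapply Rle_trans; [|exact (sum_n_le_series v K Hv HK 0)].
    rewrite sum_O. apply Hv. }
  apply (is_derive_C_quadratic h z D (rho - Cmod z) (K / rho ^ 2)).
  - lra.
  - apply Rdiv_le_0_compat; [exact HK0|apply pow_lt; lra].
  - intros w Hw.
    assert (Hwrho : Cmod w < rho).
    { replace w with ((w - z) + z)%C by ring.
      eapply Rle_lt_trans; [apply Cmod_triangle|lra]. }
    assert (Hr2 : 0 < rho ^ 2) by (apply pow_lt; lra).
    pose proof (H w ltac:(unfold in_disc; lra)) as Sw.
    pose proof (H z Hz) as Sz.
    apply (is_series_C_scal (- (1))) in Sz.
    pose proof (is_series_C_scal (- (w - z)) _ _ HD) as SD.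
    pose proof (is_series_C_plus _ _ _ _ (is_series_C_plus _ _ _ _ Sw Sz) SD) as S3.
    replace (h w - h z - D * (w - z))%C
      with (h w + - (1) * h z + - (w - z) * D)%C by ring.
    (* [Cpow_taylor] carries the factor [rho ^ 2] on its left side. *)
    apply (Rmult_le_reg_r (rho ^ 2)); [exact Hr2|].
    replace (K / rho ^ 2 * Cmod (w - z) ^ 2 * rho ^ 2)
      with (Cmod (w - z) ^ 2 * K) by (field; lra).
    rewrite <- (Rabs_pos_eq (rho ^ 2)) at 1 by lra.
    rewrite <- Cmod_R, <- Cmod_mult, Cmult_comm.
    apply (is_series_C_norm _
      (fun k => Cmod (w - z) ^ 2 *
         (Cmod (INR (p * k + S m) * (INR (p * k + S m) * a k))
          * rho ^ (p * k + S m))) _ _ (is_series_C_scal (rho ^ 2)%R _ _ S3)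
      (is_series_scal (V := R_NormedModule) _ _ _ HK)).
    intros k.
    pose proof (Cpow_taylor (p * k + S m) rho z w ltac:(lra) ltac:(lra) ltac:(lra))
      as HT.
    set (e := (p * k + S m)%nat) in *.
    assert (He : (p * k + m)%nat = pred e) by (unfold e; lia).
    rewrite He.
    replace (RtoC (rho ^ 2) *
      (a k * w ^ e + - (1) * (a k * z ^ e) + - (w - z) * (INR e * a k * z ^ pred e)))%C
      with (a k * ((w ^ e - z ^ e - INR e * z ^ pred e * (w - z)) * RtoC (rho ^ 2)))%C
      by ring.
    rewrite !Cmod_mult, !Cmod_R, (Rabs_pos_eq _ (pos_INR e)), (Rabs_pos_eq (rho ^ 2))
      by lra.
    replace (Cmod (w - z) ^ 2 * (INR e * (INR e * Cmod (a k)) * rho ^ e))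
      with (Cmod (a k) * (INR e ^ 2 * rho ^ e * Cmod (w - z) ^ 2)) by ring.
    apply Rmult_le_compat_l; [apply Cmod_ge_0|exact HT].
Qed.

Lemma has_expansion_C_derive (p m : nat) (a : nat -> C) (h : C -> C) :
  (1 <= p)%nat -> has_expansion p (S m) a h ->
  has_expansion p m (fun k => (INR (p * k + S m) * a k)%C) (C_derive h).
Proof.
  intros Hp H z Hz.
  destruct (has_expansion_is_derive p m a h z Hp H Hz) as [D [HD Hd]].
  rewrite (is_C_derive_unique _ _ _ Hd). exact HD.
Qed.

Lemma has_expansion_analytic (p m : nat) (a : nat -> C) (h : C -> C) :
  (1 <= p)%nat -> has_expansion p (S m) a h -> analytic_in_disc h.
Proof.
  intros Hp H z Hz.
  destruct (has_expansion_is_derive p m a h z Hp H Hz) as [D [_ Hd]].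
  exists D; exact Hd.
Qed.

Lemma has_expansion_at_0 (p : nat) (a : nat -> C) (h : C -> C) :
  (1 <= p)%nat -> has_expansion p 0 a h -> h 0 = a 0%nat.
Proof.
  intros Hp H.
  assert (H0 : in_disc 0) by (unfold in_disc; rewrite Cmod_0; lra).
  apply (is_series_C_unique _ _ _ (H _ H0)).
  apply is_series_C_iff. intros eps He. exists 0%nat. intros n _.
  replace (sum_n (fun k => a k * 0 ^ (p * k + 0))%C n) with (a 0%nat).
  - replace (a 0%nat - a 0%nat)%C with (RtoC 0) by ring. rewrite Cmod_0; exact He.
  - induction n as [|n IH].
    + rewrite sum_O, Nat.mul_0_r. simpl. ring.
    + rewrite sum_n_CS, <- IH. replace (p * S n + 0)%nat with (S (p * n + p - 1)) by lia.
      rewrite Cpow_S. ring.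
Qed.

(** [Nat.iter] adds derivatives on the outside, whereas the induction along the expansion takes the
    innermost derivative first. *)
Lemma C_derive_n_S (h : C -> C) (m : nat) :
  C_derive_n h (S m) = C_derive_n (C_derive h) m.
Proof.
  induction m as [|m IH]; [reflexivity|].
  unfold C_derive_n in *. simpl in *. rewrite <- IH. reflexivity.
Qed.

(** Each derivative lowers the starting exponent by one and multiplies the leading coefficient by
    that exponent; once the exponent is 0, evaluation at 0 reads off the leading coefficient. *)
Lemma C_derive_n_at_0 (p m : nat) (a : nat -> C) (h : C -> C) :
  (1 <= p)%nat -> has_expansion p m a h ->
  C_derive_n h m 0 = (INR (fact m) * a 0%nat)%C.
Proof.
  intros Hp. revert a h.
  induction m as [|m IH]; intros a h H.
  - simpl. rewrite (has_expansion_at_0 p a h Hp H). ring.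
  - rewrite C_derive_n_S.
    rewrite (IH _ _ (has_expansion_C_derive p m a h Hp H)).
    rewrite Nat.mul_0_r, Nat.add_0_l.
    replace (INR (fact (S m))) with (INR (fact m) * INR (S m)).
    + rewrite RtoC_mult. ring.
    + rewrite <- mult_INR. f_equal. simpl. lia.
Qed.

(** * Parseval comparison on circles *)

Definition cis (t : R) : C := (cos t, sin t).

Lemma sum_n_Rext (u v : nat -> R) (n : nat) :
  (forall k, u k = v k) -> sum_n u n = sum_n v n.
Proof. exact (sum_n_ext u v n). Qed.

Lemma sum_n_Cext (u v : nat -> C) (n : nat) :
  (forall k, u k = v k) -> sum_n u n = sum_n v n.
Proof. exact (sum_n_ext u v n). Qed.

Lemma cis_pow (t : R) (n : nat) : (cis t ^ n)%C = cis (INR n * t).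
Proof.
  induction n as [|n IH].
  - simpl. unfold cis. rewrite Rmult_0_l, cos_0, sin_0. reflexivity.
  - rewrite Cpow_S, IH, S_INR. unfold cis.
    replace ((INR n + 1) * t) with (t + INR n * t) by ring.
    rewrite cos_plus, sin_plus. unfold Cmult; simpl. f_equal; ring.
Qed.

Lemma Cmod_cis (t : R) : Cmod (cis t) = 1.
Proof.
  unfold Cmod, cis; simpl fst; simpl snd.
  pose proof (sin2_cos2 t) as H. unfold Rsqr in H.
  replace (cos t ^ 2 + sin t ^ 2) with 1 by nra. apply sqrt_1.
Qed.

(** With [x = PI d / N], strictly between 0 and [PI], the real part is [1 - 2 sin^2 x < 1]. *)
Lemma cis_root_neq_1 (N d : nat) : (0 < d < N)%nat -> (cis (2 * PI / INR N) ^ d)%C <> 1.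
Proof.
  intros Hd H. rewrite cis_pow in H.
  assert (HN : 0 < INR N) by (apply lt_0_INR; lia).
  assert (Hd0 : 0 < INR d) by (apply lt_0_INR; lia).
  assert (HdN : INR d < INR N) by (apply lt_INR; lia).
  set (x := PI * (INR d / INR N)).
  assert (Hq : 0 < INR d / INR N < 1).
  { split; [apply Rdiv_lt_0_compat; lra|].
    apply (Rmult_lt_reg_r (INR N)); [lra|]. field_simplify; lra. }
  replace (INR d * (2 * PI / INR N)) with (2 * x) in H by (unfold x; field; lra).
  apply (f_equal fst) in H. unfold cis in H; simpl fst in H.
  rewrite cos_2a_sin in H.
  pose proof PI_RGT_0.
  assert (0 < sin x) by (apply sin_gt_0; unfold x; nra).
  nra.
Qed.

Lemma Csum_geom (q : C) (n : nat) :
  ((1 - q) * sum_n (fun j => q ^ j) n = 1 - q ^ S n)%C.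
Proof.
  induction n as [|n IH].
  - rewrite sum_O. simpl. ring.
  - rewrite sum_n_CS, Cmult_plus_distr_l, IH, !Cpow_S. ring.
Qed.

Lemma Csum_geom_root (q : C) (n : nat) :
  q <> 1 -> (q ^ S n)%C = 1 -> sum_n (fun j => (q ^ j)%C) n = RtoC 0 :> C.
Proof.
  intros Hq H. pose proof (Csum_geom q n) as G. rewrite H in G.
  assert (Hq' : (1 - q)%C <> 0).
  { intros E. apply Hq. replace q with (1 - (1 - q))%C by ring. rewrite E. ring. }
  replace (sum_n (fun j => (q ^ j)%C) n)
    with (/ (1 - q) * ((1 - q) * sum_n (fun j => q ^ j) n))%C by (field; exact Hq').
  rewrite G. field; exact Hq'.
Qed.

Lemma Cmod2_plus (x y : C) :
  Cmod (x + y) ^ 2 = Cmod x ^ 2 + Cmod y ^ 2 + 2 * Re (x * Cconj y).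
Proof. rewrite !Cmod2_alt. destruct x, y; simpl. ring. Qed.

Lemma Re_sum_n (u : nat -> C) (n : nat) :
  Re (sum_n u n) = sum_n (fun k => Re (u k)) n.
Proof.
  induction n as [|n IH]; [rewrite !sum_O; reflexivity|].
  rewrite sum_n_CS, sum_n_S, <- IH. destruct (sum_n u n), (u (S n)). reflexivity.
Qed.


(** The order of the roots of unity is [S M] because [sum_n _ M] has [S M] terms. *)
Lemma root_pow_period (M : nat) : (cis (2 * PI / INR (S M)) ^ S M)%C = 1.
Proof.
  set (w := cis (2 * PI / INR (S M))).
  unfold w. rewrite cis_pow.
  replace (INR (S M) * (2 * PI / INR (S M))) with (2 * PI)
    by (field; apply not_0_INR; lia).
  unfold cis. rewrite cos_2PI, sin_2PI. reflexivity.
Qed.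

Lemma root_conj (M k l : nat) :
  let w := cis (2 * PI / INR (S M)) in
  (k <= l)%nat -> (w ^ k * Cconj (w ^ l) = Cconj (w ^ (l - k)))%C.
Proof.
  intros w H. replace (w ^ l)%C with (w ^ k * w ^ (l - k))%C.
  2:{ rewrite <- Cpow_add_r. f_equal. lia. }
  rewrite Cmult_conj, Cmult_assoc, <- Cmod2_conj, Cmod_pow.
  unfold w at 1. rewrite Cmod_cis, !pow1. ring.
Qed.

(** The summands are the powers of the conjugate of [w ^ (l - k)], a root of unity of order dividing
    [S M] and different from 1, so the geometric sum vanishes. *)
Lemma root_orthogonal (M k l : nat) :
  let w := cis (2 * PI / INR (S M)) in
  (k < l <= M)%nat -> sum_n (fun j => (w ^ k) ^ j * Cconj ((w ^ l) ^ j))%C M = RtoC 0 :> C.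
Proof.
  intros w H.
  rewrite (sum_n_Cext _ (fun j => (Cconj (w ^ (l - k)) ^ j)%C)).
  2:{ intros j. unfold w; rewrite <- root_conj by lia; fold w.
      rewrite Cpow_mult_l, !Cpow_conj. reflexivity. }
  apply Csum_geom_root.
  - intros E. apply (f_equal Cconj) in E. rewrite Cconj_conj in E.
    apply (cis_root_neq_1 (S M) (l - k) ltac:(lia)).
    fold w. rewrite E. apply injective_projections; simpl; ring.
  - rewrite <- Cpow_conj, <- Cpow_mult_r, Nat.mul_comm, Cpow_mult_r.
    unfold w; rewrite (root_pow_period M).
    rewrite Cpow_1_l. apply injective_projections; simpl; ring.
Qed.

Lemma root_poly_orthogonal (M n l : nat) (v : nat -> C) :
  let w := cis (2 * PI / INR (S M)) in
  (n < l <= M)%nat ->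
  sum_n (fun j => sum_n (fun k => v k * (w ^ k) ^ j) n * Cconj ((w ^ l) ^ j))%C M = RtoC 0 :> C.
Proof.
  intros w.
  induction n as [|n IH]; intros H.
  - rewrite (sum_n_Cext _ (fun j => v 0%nat * ((w ^ 0) ^ j * Cconj ((w ^ l) ^ j)))%C).
    2:{ intros j. rewrite sum_O. ring. }
    rewrite sum_n_Cscal; unfold w; rewrite root_orthogonal by lia. ring.
  - rewrite (sum_n_Cext _ (fun j =>
      sum_n (fun k => v k * (w ^ k) ^ j) n * Cconj ((w ^ l) ^ j)
      + v (S n) * ((w ^ S n) ^ j * Cconj ((w ^ l) ^ j)))%C).
    2:{ intros j. rewrite sum_n_CS. ring. }
    rewrite sum_n_Cadd, sum_n_Cscal, IH by lia; unfold w; rewrite root_orthogonal by lia. ring.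
Qed.

(** A new term of degree [n + 1] adds [|v_(n+1)|^2] at each node and a cross term with the part of
    lower degree. The cross terms cancel over all nodes because there are more nodes than the
    degree. *)
Lemma discrete_parseval (M n : nat) (v : nat -> C) :
  let w := cis (2 * PI / INR (S M)) in
  (n <= M)%nat ->
  sum_n (fun j => Cmod (sum_n (fun k => v k * (w ^ k) ^ j)%C n) ^ 2) M
  = INR (S M) * sum_n (fun k => Cmod (v k) ^ 2) n :> R.
Proof.
  intros w.
  assert (Hw : forall k j, Cmod ((w ^ k) ^ j)%C = 1).
  { intros k j. rewrite !Cmod_pow. unfold w. rewrite Cmod_cis, !pow1. reflexivity. }
  induction n as [|n IH]; intros H.
  - rewrite (sum_n_Rext _ (fun _ => Cmod (v 0%nat) ^ 2)).
    2:{ intros j. rewrite sum_O, Cmod_mult, Hw, Rmult_1_r. reflexivity. }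
    rewrite sum_n_const, sum_O. reflexivity.
  - rewrite (sum_n_Rext _ (fun j =>
      (Cmod (sum_n (fun k => v k * (w ^ k) ^ j)%C n) ^ 2 + Cmod (v (S n)) ^ 2)
      + 2 * Re (Cconj (v (S n)) *
          (sum_n (fun k => v k * (w ^ k) ^ j)%C n * Cconj ((w ^ S n) ^ j))))).
    2:{ intros j. rewrite sum_n_CS, Cmod2_plus, Cmod_mult, Hw, Rmult_1_r.
        rewrite Cmult_conj. do 3 f_equal. ring. }
    rewrite sum_n_add, sum_n_add, sum_n_scal, <- Re_sum_n, sum_n_Cscal.
    unfold w at 2 3; rewrite root_poly_orthogonal by lia.
    rewrite IH by lia. rewrite sum_n_const, sum_n_S, Cmult_0_r.
    simpl Re. ring.
Qed.

(** The root [q] has order [p (n + 1)], so [q ^ p] has order [n + 1], and the [n + 1] sample points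
    suffice for a polynomial of degree [n] in [z ^ p]. The remaining factor [(q ^ j) ^ m] has
    modulus 1. *)
Lemma circle_parseval (p m n : nat) (c : nat -> C) (r : R) :
  (1 <= p)%nat -> 0 < r ->
  let z := fun j : nat => (r * cis (2 * PI / INR (p * S n)) ^ j)%C in
  sum_n (fun j => Cmod (sum_n (fun k => c k * z j ^ (p * k + m))%C n) ^ 2) n
  = INR (S n) * sum_n (fun k => Cmod (c k) ^ 2 * (r ^ (p * k + m)) ^ 2) n :> R.
Proof.
  intros Hp Hr z.
  set (q := cis (2 * PI / INR (p * S n))) in z.
  assert (Hq : Cmod q = 1) by apply Cmod_cis.
  assert (Hqp : (q ^ p)%C = cis (2 * PI / INR (S n))).
  { unfold q. rewrite cis_pow, mult_INR. f_equal. field.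
    split; apply not_0_INR; lia. }
  set (v := fun k => (c k * RtoC (r ^ (p * k + m)))%C).
  rewrite (sum_n_Rext _ (fun j =>
    Cmod (sum_n (fun k => v k * (cis (2 * PI / INR (S n)) ^ k) ^ j)%C n) ^ 2)).
  - rewrite (discrete_parseval n n v (Nat.le_refl n)). f_equal.
    apply sum_n_Rext. intros k. unfold v.
    rewrite Cmod_mult, Cmod_R, Rabs_pos_eq by (apply pow_le; lra).
    apply Rpow_mult_distr.
  - intros j. rewrite <- Hqp.
    replace (sum_n (fun k => c k * z j ^ (p * k + m))%C n)
      with ((q ^ j) ^ m * sum_n (fun k => v k * ((q ^ p) ^ k) ^ j)%C n)%C.
    + rewrite Cmod_mult, !Cmod_pow, Hq, !pow1, Rmult_1_l. reflexivity.
    + rewrite <- sum_n_Cscal. apply sum_n_Cext. intros k. unfold v, z.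
      rewrite Cpow_mult_l, RtoC_pow.
      replace ((q ^ j) ^ (p * k + m))%C with (((q ^ p) ^ k) ^ j * (q ^ j) ^ m)%C.
      * ring.
      * rewrite <- !Cpow_mult_r, <- Cpow_add_r. f_equal. ring.
Qed.

Lemma is_series_R_eps (u : nat -> R) (l : R) :
  is_series u l -> forall eps, 0 < eps ->
  exists N, forall n, (N <= n)%nat -> Rabs (sum_n u n - l) < eps.
Proof.
  intros H eps He.
  assert (Hl : is_lim_seq (sum_n u) l) by exact H.
  apply is_lim_seq_spec in Hl. exact (Hl (mkposreal eps He)).
Qed.

(** On the circle the truncations of degree [n] differ from the functions by uniformly small tails,
    so [|P1| <= |P2| + tau] at each sample point; squaring and averaging over the [n + 1] points
    gives the claim. Only moduli on the circle enter, hence the two starting exponents may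
    differ. *)
Lemma parseval_comparison (p m1 m2 : nat) (c1 c2 : nat -> C) (H1 H2 : C -> C) (r : R) :
  (1 <= p)%nat -> has_expansion p m1 c1 H1 -> has_expansion p m2 c2 H2 ->
  0 < r < 1 -> (forall z, Cmod z = r -> Cmod (H1 z) <= Cmod (H2 z)) ->
  forall eps, 0 < eps -> exists N, forall n, (N <= n)%nat ->
    sum_n (fun k => Cmod (c1 k) ^ 2 * (r ^ (p * k + m1)) ^ 2) n
    <= sum_n (fun k => Cmod (c2 k) ^ 2 * (r ^ (p * k + m2)) ^ 2) n + eps.
Proof.
  intros Hp E1 E2 Hr Hle eps Heps.
  destruct (has_expansion_abs_summable _ _ _ _ Hp E1 r ltac:(lra)) as [s1 S1].
  destruct (has_expansion_abs_summable _ _ _ _ Hp E2 r ltac:(lra)) as [s2 S2].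
  set (v1 := fun k => Cmod (c1 k) * r ^ (p * k + m1)) in S1.
  set (v2 := fun k => Cmod (c2 k) * r ^ (p * k + m2)) in S2.
  assert (Hv1 : forall k, 0 <= v1 k)
    by (intros k; apply Rmult_le_pos; [apply Cmod_ge_0|apply pow_le; lra]).
  assert (Hv2 : forall k, 0 <= v2 k)
    by (intros k; apply Rmult_le_pos; [apply Cmod_ge_0|apply pow_le; lra]).
  assert (Hs2 : 0 <= s2).
  { eapply Rle_trans; [apply (Hv2 0%nat)|].
    pose proof (sum_n_le_series v2 s2 Hv2 S2 0) as H. rewrite sum_O in H. exact H. }
  (* Since [|P2| <= s2], squaring costs at most [2 tau s2 + tau^2 <= tau (2 s2 + 1) <= eps]. *)
  set (tau := Rmin 1 (eps / (2 * s2 + 1))).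
  assert (Htau : 0 < tau /\ tau <= 1 /\ tau * (2 * s2 + 1) <= eps).
  { repeat split.
    - apply Rmin_pos; [lra|]. apply Rdiv_lt_0_compat; lra.
    - apply Rmin_l.
    - replace eps with (eps / (2 * s2 + 1) * (2 * s2 + 1)) by (field; lra).
      apply Rmult_le_compat_r; [lra|apply Rmin_r]. }
  assert (Htail : forall (v : nat -> R) (s : R), is_series v s -> (forall k, 0 <= v k) ->
    exists N, forall n, (N <= n)%nat -> 0 <= s - sum_n v n < tau / 2).
  { intros v s Hs Hv.
    destruct (is_series_R_eps v s Hs (tau / 2) ltac:(lra)) as [N HN].
    exists N. intros n Hn. specialize (HN n Hn).
    pose proof (sum_n_le_series v s Hv Hs n).
    rewrite Rabs_minus_sym, Rabs_pos_eq in HN by lra. lra. }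
  destruct (Htail v1 s1 S1 Hv1) as [N1 HN1].
  destruct (Htail v2 s2 S2 Hv2) as [N2 HN2].
  exists (max N1 N2). intros n Hn.
  specialize (HN1 n ltac:(lia)). specialize (HN2 n ltac:(lia)).
  apply (Rmult_le_reg_l (INR (S n))); [apply lt_0_INR; lia|].
  rewrite Rmult_plus_distr_l.
  rewrite <- !(circle_parseval p _ n _ r Hp (proj1 Hr)).
  rewrite <- (sum_n_const n eps), <- sum_n_add.
  apply sum_n_le_loc. intros j _.
  set (z := (r * cis (2 * PI / INR (p * S n)) ^ j)%C).
  assert (Hz : Cmod z = r).
  { unfold z. rewrite Cmod_mult, Cmod_pow, Cmod_cis, pow1, Cmod_R, Rabs_pos_eq; lra. }
  assert (Hzd : in_disc z) by (unfold in_disc; lra).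
  set (P1 := sum_n (fun k => c1 k * z ^ (p * k + m1))%C n).
  set (P2 := sum_n (fun k => c2 k * z ^ (p * k + m2))%C n).
  assert (T1 : Cmod (H1 z - P1) <= s1 - sum_n v1 n).
  { apply (is_series_C_tail _ v1 _ _ (E1 z Hzd) S1).
    intros k. rewrite Cmod_mult, Cmod_pow, Hz. apply Rle_refl. }
  assert (T2 : Cmod (H2 z - P2) <= s2 - sum_n v2 n).
  { apply (is_series_C_tail _ v2 _ _ (E2 z Hzd) S2).
    intros k. rewrite Cmod_mult, Cmod_pow, Hz. apply Rle_refl. }
  assert (B2 : Cmod P2 <= s2).
  { eapply Rle_trans; [apply Cmod_sum_n|].
    eapply Rle_trans; [|apply (sum_n_le_series v2 s2 Hv2 S2 n)].
    apply sum_n_le_loc. intros k _. rewrite Cmod_mult, Cmod_pow, Hz. apply Rle_refl. }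
  assert (B1 : Cmod P1 <= Cmod P2 + tau).
  { replace P1 with (H1 z + - (H1 z - P1))%C by ring.
    eapply Rle_trans; [apply Cmod_triangle|]. rewrite Cmod_opp.
    assert (Cmod (H2 z) <= Cmod P2 + Cmod (H2 z - P2)).
    { replace (H2 z) with (P2 + (H2 z - P2))%C at 1 by ring. apply Cmod_triangle. }
    specialize (Hle z Hz). lra. }
  pose proof (Cmod_ge_0 P1). pose proof (Cmod_ge_0 P2).
  nra.
Qed.

(** * Coefficients of bounded functions *)

(** Coefficients of [z ^ (p * L) * h z] when [a] are those of [h]. *)
Definition shift (L : nat) (a : nat -> C) (k : nat) : C :=
  if (k <? L)%nat then RtoC 0 else a (k - L)%nat.

Lemma shift_lt (L : nat) (a : nat -> C) (k : nat) : (k < L)%nat -> shift L a k = 0.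
Proof. intros H. unfold shift. apply Nat.ltb_lt in H. rewrite H. reflexivity. Qed.

Lemma shift_ge (L : nat) (a : nat -> C) (k : nat) :
  (L <= k)%nat -> shift L a k = a (k - L)%nat.
Proof. intros H. unfold shift. apply Nat.ltb_ge in H. rewrite H. reflexivity. Qed.

Lemma has_expansion_ext (p m : nat) (a b : nat -> C) (h : C -> C) :
  (forall k, a k = b k) -> has_expansion p m a h -> has_expansion p m b h.
Proof.
  intros E H z Hz. apply (is_series_ext (fun k => (a k * z ^ (p * k + m))%C)).
  - intros k. rewrite E. reflexivity.
  - exact (H z Hz).
Qed.

Lemma has_expansion_scal (p m : nat) (c : C) (a : nat -> C) (h : C -> C) :
  has_expansion p m a h ->
  has_expansion p m (fun k => (c * a k)%C) (fun z => (c * h z)%C).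
Proof.
  intros H z Hz.
  apply (is_series_ext (fun k => (c * (a k * z ^ (p * k + m)))%C)).
  - intros k. apply Cmult_assoc.
  - exact (is_series_C_scal _ _ _ (H z Hz)).
Qed.

Lemma has_expansion_plus (p m : nat) (a b : nat -> C) (h g : C -> C) :
  has_expansion p m a h -> has_expansion p m b g ->
  has_expansion p m (fun k => (a k + b k)%C) (fun z => (h z + g z)%C).
Proof.
  intros H G z Hz.
  apply (is_series_ext (fun k => (a k * z ^ (p * k + m) + b k * z ^ (p * k + m))%C)).
  - intros k. symmetry. apply Cmult_plus_distr_r.
  - exact (is_series_C_plus _ _ _ _ (H z Hz) (G z Hz)).
Qed.

Lemma has_expansion_shift (p m L : nat) (a : nat -> C) (h : C -> C) :
  has_expansion p m a h ->
  has_expansion p m (shift L a) (fun z => (z ^ (p * L) * h z)%C).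
Proof.
  intros H z Hz.
  pose proof (proj1 (is_series_C_iff _ _)
                (is_series_C_scal (z ^ (p * L)) _ _ (H z Hz))) as HS.
  apply is_series_C_iff. intros eps He.
  destruct (HS eps He) as [N HN]. exists (N + L)%nat. intros n Hn.
  replace (sum_n (fun k => (shift L a k * z ^ (p * k + m))%C) n)
    with (sum_n (fun k => (z ^ (p * L) * (a k * z ^ (p * k + m)))%C) (n - L)).
  { apply HN. lia. }
  assert (HL : forall n, (n < L)%nat ->
    sum_n (fun k => (shift L a k * z ^ (p * k + m))%C) n = RtoC 0 :> C).
  { intros i; induction i as [|i IH]; intros Hi.
    - rewrite sum_O, shift_lt by lia. C_ring.
    - rewrite sum_n_CS, IH, shift_lt by lia. C_ring. }
  replace n with (L + (n - L))%nat at 2 by lia.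
  induction (n - L)%nat as [|i IH].
  - rewrite sum_O, Nat.add_0_r. destruct L as [|L'].
    + rewrite sum_O, shift_ge by lia. rewrite Nat.mul_0_r. simpl. C_ring.
    + rewrite sum_n_CS, HL, shift_ge, Nat.sub_diag by lia.
      rewrite Nat.mul_0_r, Nat.add_0_l, Cpow_add_r. C_ring.
  - rewrite <- plus_n_Sm, !sum_n_CS, IH, shift_ge by lia.
    replace (S (L + i) - L)%nat with (S i) by lia.
    replace (p * S (L + i) + m)%nat with (p * L + (p * S i + m))%nat by lia.
    rewrite (Cpow_add_r z (p * L)). C_ring.
Qed.

(** The monomial [z ^ m] viewed as an expansion with step [p]; it serves both in the test functions
    and as an extremal function. *)
Definition unit_seq (k : nat) : C := match k with O => RtoC 1 | S _ => RtoC 0 end.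

Lemma has_expansion_pow (p m : nat) : has_expansion p m unit_seq (fun z => (z ^ m)%C).
Proof.
  intros z _. apply is_series_C_iff. intros eps He. exists 0%nat. intros n _.
  replace (sum_n (fun k => unit_seq k * z ^ (p * k + m))%C n) with (z ^ m)%C.
  - replace (z ^ m - z ^ m)%C with (RtoC 0) by ring. rewrite Cmod_0; exact He.
  - induction n as [|n IH].
    + rewrite sum_O, Nat.mul_0_r. simpl. C_ring.
    + rewrite sum_n_CS, <- IH. simpl. C_ring.
Qed.

Lemma sum_n_single_le (j n : nat) (x : R) :
  0 <= x -> sum_n (fun k => if (k =? j)%nat then x else 0) n <= x.
Proof.
  intros Hx.
  assert (H : ((n < j)%nat -> sum_n (fun k => if (k =? j)%nat then x else 0) n = 0 :> R) /\
              sum_n (fun k => if (k =? j)%nat then x else 0) n <= x).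
  { induction n as [|n [IH1 IH2]].
    - rewrite sum_O. destruct j; simpl; split; (lia || lra || intros; lra).
    - rewrite sum_n_S. destruct (Nat.eqb_spec (S n) j) as [<-|Hne].
      + split; [lia|]. rewrite IH1 by lia. lra.
      + split; [intros; rewrite IH1 by lia; lra|lra]. }
  exact (proj2 H).
Qed.

Lemma sum_n_incr (u : nat -> R) (n m : nat) :
  (forall k, 0 <= u k) -> (n <= m)%nat -> sum_n u n <= sum_n u m.
Proof.
  intros Hu H. induction H as [|m H IH]; [lra|].
  rewrite sum_n_S. specialize (Hu (S m)). lra.
Qed.

Lemma continuity_pt_sum_n (f : nat -> R -> R) (x : R) (n : nat) :
  (forall k, continuity_pt (f k) x) ->
  continuity_pt (fun t => sum_n (fun k => f k t) n) x.
Proof.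
  intros H. induction n as [|n IH].
  - apply (continuity_pt_ext (f 0%nat)); [|apply H].
    intros t. symmetry. apply (sum_O (fun k => f k t)).
  - apply (continuity_pt_ext (fun t => sum_n (fun k => f k t) n + f (S n) t)).
    + intros t. symmetry. apply (sum_n_S (fun k => f k t)).
    + exact (continuity_pt_plus _ _ _ IH (H (S n))).
Qed.

Lemma continuity_pt_monomial (c x : R) (e : nat) :
  continuity_pt (fun t => c * t ^ e) x.
Proof. apply derivable_continuous_pt. reg. Qed.

(** Circle estimates need a radius below 1, but the finite sums they bound are polynomials in the
    radius; this carries them to radius 1. *)
Lemma le_at_1_of_continuous (f : R -> R) (B : R) :
  continuity_pt f 1 -> (forall r, 0 < r < 1 -> f r <= B) -> f 1 <= B.
Proof.
  intros Hc H. apply Rnot_lt_le. intros Hlt.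
  destruct (Hc (f 1 - B) ltac:(lra)) as [d [Hd HD]].
  set (r := 1 - Rmin (1/2) (d / 2)).
  assert (Hm : 0 < Rmin (1/2) (d/2)) by (apply Rmin_pos; lra).
  pose proof (Rmin_l (1/2) (d/2)). pose proof (Rmin_r (1/2) (d/2)).
  assert (Hr : 0 < r < 1) by (unfold r; lra).
  specialize (H r Hr).
  specialize (HD r). simpl in HD. unfold R_dist in HD.
  assert (HD' : Rabs (f r - f 1) < f 1 - B).
  { apply HD. split.
    - split; [exact I|]. intros E. lra.
    - rewrite Rabs_left; unfold r in *; lra. }
  rewrite Rabs_left1 in HD'; lra.
Qed.

(* Multiply [h] by the test function [alpha + beta z^(p L)] and compare the
   norms in the Hardy space. *)
Lemma toeplitz_contraction (p m l : nat) (a : nat -> C) (h : C -> C) (M : R)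
    (alpha beta : C) :
  (1 <= p)%nat -> has_expansion p m a h -> 0 <= M ->
  (forall z, in_disc z -> Cmod (h z) <= M) ->
  Cmod alpha ^ 2 * sum_n (fun k => Cmod (a k) ^ 2) l
    + Cmod (alpha * a (S l) + beta * a 0%nat) ^ 2
  <= M ^ 2 * (Cmod alpha ^ 2 + Cmod beta ^ 2).
Proof.
  intros Hp H HM Hb.
  pose (L := S l).
  set (c1 := fun k => (alpha * a k + beta * shift L a k)%C).
  set (c2 := fun k => (M * (alpha * unit_seq k + beta * shift L unit_seq k))%C).
  set (q := fun z : C => (alpha + beta * z ^ (p * L))%C).
  assert (E1 : has_expansion p m c1
                 (fun z => (alpha * h z + beta * (z ^ (p * L) * h z))%C)).
  { apply has_expansion_plus; apply has_expansion_scal; [exact H|].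
    apply has_expansion_shift; exact H. }
  assert (E2 : has_expansion p 0 c2
                 (fun z => (M * (alpha * z ^ 0 + beta * (z ^ (p * L) * z ^ 0)))%C)).
  { apply has_expansion_scal.
    apply has_expansion_plus; apply has_expansion_scal.
    - apply has_expansion_pow.
    - apply (has_expansion_shift p 0 L unit_seq (fun z => (z ^ 0)%C)).
      apply has_expansion_pow. }
  (* Below index [L] the product has the coefficients [alpha a_k]; at [L] the shifted copy of [h]
     first contributes, with [beta a_0]. The later coefficients are dropped from the lower bound. *)
  replace (Cmod alpha ^ 2 * sum_n (fun k => Cmod (a k) ^ 2) l
    + Cmod (alpha * a (S l) + beta * a 0%nat) ^ 2)
    with (sum_n (fun k => Cmod (c1 k) ^ 2) (S l)).
  2:{ rewrite sum_n_S. f_equal.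
      - rewrite <- sum_n_scal. apply sum_n_ext_loc. intros k Hk. unfold c1.
        rewrite shift_lt by (unfold L; lia). rewrite Cmult_0_r, Cplus_0_r, Cmod_mult.
        apply Rpow_mult_distr.
      - unfold c1. rewrite shift_ge by (unfold L; lia).
        unfold L. rewrite Nat.sub_diag. reflexivity. }
  set (f := fun r => sum_n (fun k => Cmod (c1 k) ^ 2 * r ^ ((p * k + m) * 2)) (S l)).
  replace (sum_n (fun k => Cmod (c1 k) ^ 2) (S l)) with (f 1).
  2:{ apply sum_n_Rext. intros k. rewrite pow1. apply Rmult_1_r. }
  apply le_at_1_of_continuous.
  { apply continuity_pt_sum_n. intros k. apply continuity_pt_monomial. }
  intros r Hr. apply le_epsilon. intros eps Heps.
  destruct (parseval_comparison p m 0 c1 c2 _ _ r Hp E1 E2 Hr) with (eps := eps)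
    as [N HN]; [|exact Heps|].
  { intros z Hz.
    replace (alpha * h z + beta * (z ^ (p * L) * h z))%C with (h z * q z)%C
      by (unfold q; ring).
    replace (M * (alpha * z ^ 0 + beta * (z ^ (p * L) * z ^ 0)))%C with (M * q z)%C
      by (unfold q; simpl; ring).
    rewrite !Cmod_mult, Cmod_R, (Rabs_pos_eq M HM).
    apply Rmult_le_compat_r; [apply Cmod_ge_0|]. apply Hb. unfold in_disc; lra. }
  specialize (HN (N + S l)%nat ltac:(lia)).
  eapply Rle_trans; [eapply Rle_trans; [|exact HN]|].
  - eapply Rle_trans; [|apply (sum_n_incr _ (S l))].
    + apply sum_n_le_loc. intros k _. rewrite pow_mult. apply Rle_refl.
    + intros k. apply Rmult_le_pos; apply pow2_ge_0.
    + lia.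
  - apply Rplus_le_compat_r.
    (* [M] times the test function has only two nonzero coefficients, at 0 and at [L]; the powers of
       [r] are at most 1. *)
    apply Rle_trans with (sum_n (fun k =>
      (if (k =? 0)%nat then M ^ 2 * Cmod alpha ^ 2 else 0)
      + (if (k =? L)%nat then M ^ 2 * Cmod beta ^ 2 else 0)) (N + S l)).
    + apply sum_n_le_loc. intros k _.
      pose proof (pow_le_one (r ^ (p * k + 0)) 2 (pow_le_one r _ ltac:(lra))) as Hpw.
      set (x := (r ^ (p * k + 0)) ^ 2) in *.
      unfold c2. rewrite Cmod_mult, Cmod_R, (Rabs_pos_eq M HM).
      destruct (Nat.eqb_spec k 0) as [->|Hk0].
      * rewrite shift_lt by (unfold L; lia). simpl unit_seq.
        replace (alpha * 1 + beta * 0)%C with alpha by ring.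
        destruct (Nat.eqb_spec 0 L) as [E|_]; [unfold L in E; lia|].
        rewrite Rpow_mult_distr.
        pose proof (Rmult_le_pos _ _ (pow2_ge_0 M) (pow2_ge_0 (Cmod alpha))). nra.
      * replace (unit_seq k) with (RtoC 0) by (destruct k; [lia|reflexivity]).
        destruct (Nat.eqb_spec k L) as [->|HkL].
        -- rewrite shift_ge, Nat.sub_diag by lia. simpl unit_seq.
           replace (alpha * 0 + beta * 1)%C with beta by ring.
           rewrite Rpow_mult_distr.
           pose proof (Rmult_le_pos _ _ (pow2_ge_0 M) (pow2_ge_0 (Cmod beta))). nra.
        -- replace (shift L unit_seq k) with (RtoC 0).
           ++ replace (alpha * 0 + beta * 0)%C with (RtoC 0) by ring.
              rewrite Cmod_0. lra.
           ++ destruct (Nat.lt_ge_cases k L) as [HL|HL].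
              ** rewrite shift_lt by exact HL. reflexivity.
              ** rewrite shift_ge by exact HL.
                 destruct (k - L)%nat eqn:E; [lia|reflexivity].
    + rewrite sum_n_add, Rmult_plus_distr_l.
      apply Rplus_le_compat; apply sum_n_single_le;
        apply Rmult_le_pos; apply pow2_ge_0.
Qed.

(** The first bound tests with the constant function 1. The second uses the pair [(alpha, beta)]
    proportional to [(x conj a_L, u conj a_0)], for which the pairing collapses to [u M^2]; one
    factor [u] and one factor [x] then cancel. *)
Lemma bounded_coefficients (p m l : nat) (a : nat -> C) (h : C -> C) (M : R) :
  (1 <= p)%nat -> has_expansion p m a h -> 0 <= M ->
  (forall z, in_disc z -> Cmod (h z) <= M) ->
  sum_n (fun k => Cmod (a k) ^ 2) l <= M ^ 2 /\
  M ^ 2 * Cmod (a (S l)) ^ 2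
  <= (M ^ 2 - Cmod (a 0%nat) ^ 2) * (M ^ 2 - sum_n (fun k => Cmod (a k) ^ 2) l).
Proof.
  intros Hp H HM Hb.
  set (A := sum_n (fun k => Cmod (a k) ^ 2) l).
  set (u := Cmod (a (S l)) ^ 2). set (v := Cmod (a 0%nat) ^ 2).
  assert (HA : A + u <= M ^ 2).
  { pose proof (toeplitz_contraction p m l a h M 1 0 Hp H HM Hb) as T.
    replace (1 * a (S l) + 0 * a 0%nat)%C with (a (S l)) in T by ring.
    rewrite Cmod_1, Cmod_0 in T. fold A u in T. lra. }
  assert (Hu : 0 <= u) by apply pow2_ge_0.
  assert (HvA : v <= A).
  { unfold v, A. eapply Rle_trans; [|apply (sum_n_incr _ 0)].
    - rewrite sum_O. apply Rle_refl.
    - intros k. apply pow2_ge_0.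
    - lia. }
  split; [lra|].
  set (x := M ^ 2 - v).
  (* equality case of Cauchy-Schwarz for the pairing [alpha a_L + beta a_0] *)
  pose proof (toeplitz_contraction p m l a h M (x * Cconj (a (S l)))
                (u * Cconj (a 0%nat)) Hp H HM Hb) as T.
  replace (x * Cconj (a (S l)) * a (S l) + u * Cconj (a 0%nat) * a 0%nat)%C
    with (RtoC (x * u + u * v)) in T.
  2:{ unfold u at 1, v. rewrite RtoC_plus, !RtoC_mult.
      rewrite (Cmod2_conj (a (S l))), (Cmod2_conj (a 0%nat)). ring. }
  rewrite !Cmod_mult, !Cmod_conj, !Cmod_R, !Rpow_mult_distr in T.
  rewrite !pow2_abs in T. fold A u v in T.
  replace (x * u + u * v) with (u * M ^ 2) in T by (unfold x; ring).
  (* Cancelling [u] needs [u <> 0]; for [u = 0] the claim is that a product of nonnegative factors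
     is nonnegative. *)
  destruct (Req_dec u 0) as [->|Hu0].
  { rewrite Rmult_0_r. apply Rmult_le_pos; unfold x in *; lra. }
  assert (Hup : 0 < u) by lra.
  assert (T' : x ^ 2 * A + u * M ^ 2 * M ^ 2 <= M ^ 2 * x ^ 2 + M ^ 2 * u * v).
  { apply (Rmult_le_reg_l u); [exact Hup|]. nra. }
  (* From [v + u <= A + u <= M^2] one gets [x >= u > 0]. *)
  assert (Hx : 0 < x) by (unfold x; lra).
  apply (Rmult_le_reg_l x); [exact Hx|].
  replace (x * (M ^ 2 * u)) with (u * M ^ 2 * M ^ 2 - M ^ 2 * u * v) by (unfold x; ring).
  fold x. nra.
Qed.

(** The hypothesis says [A (n + 1) - v A n <= (1 - v)^2] for the unweighted tail sums [A]; Abel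
    summation turns this into [T (n + 1) - v rho T n <= rho (1 - v)^2] for the weighted ones, and
    [T] is nondecreasing. The squared coefficients of a Blaschke factor, [u_k = (1 - v)^2 v^(k-1)]
    for [k >= 1], give equality in the limit. *)
Lemma weighted_tail_bound (u : nat -> R) (rho : R) (n : nat) :
  (forall k, 0 <= u k) -> (forall l, sum_n u l <= 1) ->
  (forall l, u (S l) <= (1 - u 0%nat) * (1 - sum_n u l)) ->
  0 <= rho <= 1 ->
  sum_n (fun k => u (S k) * rho ^ S k) n * (1 - u 0%nat * rho)
  <= rho * (1 - u 0%nat) ^ 2.
Proof.
  intros Hu0 Hu1 Hu Hrho.
  set (v := u 0%nat) in *.
  set (A := (fun n => sum_n (fun k => u (S k)) n) : nat -> R).
  set (T := (fun n => sum_n (fun k => u (S k) * rho ^ S k) n) : nat -> R).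
  assert (Hv : 0 <= v <= 1).
  { split; [apply Hu0|]. specialize (Hu1 0%nat). rewrite sum_O in Hu1. exact Hu1. }
  assert (HS : forall n, sum_n u (S n) = v + A n :> R).
  { intros i; induction i as [|i IH].
    - rewrite sum_n_S; unfold A; rewrite !sum_O; reflexivity.
    - rewrite sum_n_S, IH. unfold A. rewrite sum_n_S. ring. }
  assert (HA : forall n, A (S n) = A n + u (S (S n)))
    by (intros; apply (sum_n_S (fun k => u (S k)))).
  assert (HT : forall n, T (S n) = T n + u (S (S n)) * rho ^ S (S n))
    by (intros; apply (sum_n_S (fun k => u (S k) * rho ^ S k))).
  assert (HT0 : forall n, 0 <= T n).
  { intros i. apply sum_n_nonneg. intros k _.
    apply Rmult_le_pos; [apply Hu0|apply pow_le; lra]. }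
  assert (H0 : u 1%nat <= (1 - v) ^ 2).
  { specialize (Hu 0%nat). rewrite sum_O in Hu. fold v in Hu. nra. }
  assert (HG : forall n, A (S n) - v * A n <= (1 - v) ^ 2).
  { intros i. specialize (Hu (S i)). rewrite HS in Hu. rewrite HA. nra. }
  (* Abel summation against the decreasing weights [rho ^ k] *)
  assert (HP : forall n, T (S n) - v * rho * T n
    <= rho * (1 - v) ^ 2 - rho ^ S (S n) * ((1 - v) ^ 2 - (A (S n) - v * A n))).
  { intros i; induction i as [|i IH].
    - rewrite HT, HA. unfold T, A. rewrite !sum_O. simpl.
      assert (0 <= rho * (1 - rho) * ((1 - v) ^ 2 - u 1%nat)).
      { apply Rmult_le_pos; [apply Rmult_le_pos; lra|lra]. }
      simpl in *. nra.
    - pose proof (HG i) as HGi.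
      pose proof (HT (S i)) as E1. pose proof (HT i) as E2.
      pose proof (HA (S i)) as E3. pose proof (HA i) as E4.
      assert (Hw : 0 <= rho ^ S (S i)) by (apply pow_le; lra).
      assert (0 <= rho ^ S (S i) * (1 - rho) * ((1 - v) ^ 2 - (A (S i) - v * A i))).
      { apply Rmult_le_pos; [apply Rmult_le_pos; lra|lra]. }
      change (rho ^ S (S (S i))) with (rho * rho ^ S (S i)) in *.
      rewrite E1, E3.
      replace (v * rho * T (S i))
        with (v * rho * T i + v * rho * u (S (S i)) * rho ^ S (S i))
        by (rewrite E2; ring).
      replace (v * A (S i)) with (v * A i + v * u (S (S i))) by (rewrite E4; ring).
      nra. }
  change (sum_n (fun k => u (S k) * rho ^ S k) n) with (T n).
  destruct n as [|n].
  - unfold T. rewrite sum_O, pow_1.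
    assert (0 <= u 1%nat * rho) by (apply Rmult_le_pos; [apply Hu0|lra]).
    assert (0 <= u 1%nat * rho * (v * rho)) by (apply Rmult_le_pos; nra).
    assert (rho * u 1%nat <= rho * (1 - v) ^ 2) by (apply Rmult_le_compat_l; lra).
    lra.
  - specialize (HP n). specialize (HG n).
    assert (Hw : 0 <= rho ^ S (S n)) by (apply pow_le; lra).
    assert (Hm : T n <= T (S n)).
    { rewrite HT. specialize (Hu0 (S (S n))).
      pose proof (Rmult_le_pos _ _ Hu0 Hw). lra. }
    assert (v * rho * T n <= v * rho * T (S n))
      by (apply Rmult_le_compat_l; [nra|exact Hm]).
    assert (0 <= rho ^ S (S n) * ((1 - v) ^ 2 - (A (S n) - v * A n)))
      by (apply Rmult_le_pos; lra).
    lra.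
Qed.

(** * Coefficients under the dilatation condition *)

(* The limit inferior of the partial sums is nonnegative; no value of the
   series has to be named. *)
Definition eventually_nonneg_sums (u : nat -> R) : Prop :=
  forall eps, 0 < eps -> exists N, forall n, (N <= n)%nat -> - eps <= sum_n u n.

Lemma derivable_pt_lim_sum_n (f g : nat -> R -> R) (x : R) (n : nat) :
  (forall k, derivable_pt_lim (f k) x (g k x)) ->
  derivable_pt_lim (fun t => sum_n (fun k => f k t) n) x (sum_n (fun k => g k x) n).
Proof.
  intros H. apply is_derive_Reals.
  apply (is_derive_sum_n (V := R_NormedModule) f n x (fun k => g k x)).
  intros k _. apply is_derive_Reals, H.
Qed.

(* On [0, X] the [n]-th partial sum is at least [- tau t / X], where [tau] is
   the tail of the absolute series at [X]; integrate [1 / t] times this. *)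
Lemma eventually_nonneg_sums_div (e : nat -> nat) (A : nat -> R) :
  (forall k, (1 <= e k)%nat) ->
  (forall x, 0 < x < 1 -> ex_series (fun k => Rabs (A k) * x ^ e k)) ->
  (forall x, 0 < x < 1 -> eventually_nonneg_sums (fun k => A k * x ^ e k)) ->
  forall x, 0 < x < 1 -> eventually_nonneg_sums (fun k => A k / INR (e k) * x ^ e k).
Proof.
  intros He Hs Hp X HX tau Htau.
  destruct (Hs X HX) as [s Sv].
  set (v := fun k => Rabs (A k) * X ^ e k) in Sv.
  assert (Hv : forall k, 0 <= v k)
    by (intros k; apply Rmult_le_pos; [apply Rabs_pos|apply pow_le; lra]).
  destruct (is_series_R_eps v s Sv tau Htau) as [N HN].
  exists N. intros n Hn. specialize (HN n Hn).
  pose proof (sum_n_le_series v s Hv Sv) as Hvs.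
  rewrite Rabs_minus_sym, Rabs_pos_eq in HN by (specialize (Hvs n); lra).
  (* Far partial sums are almost nonnegative, and what lies beyond [n] is at most [tau t / X], since
     [t ^ e <= (t / X) X ^ e] for [e >= 1]. *)
  assert (HP : forall t, 0 < t < X ->
    - (tau * (t / X)) <= sum_n (fun k => A k * t ^ e k) n).
  { intros t Ht. apply le_epsilon. intros eps Heps.
    destruct (Hp t ltac:(lra) eps Heps) as [N' HN'].
    specialize (HN' (n + N')%nat ltac:(lia)).
    assert (Hq : 0 < t / X < 1).
    { split; [apply Rdiv_lt_0_compat; lra|].
      apply (Rmult_lt_reg_r X); [lra|]. field_simplify; lra. }
    assert (Hd : forall i, sum_n (fun k => A k * t ^ e k) (n + i)
       - sum_n (fun k => A k * t ^ e k) n <= t / X * (sum_n v (n + i) - sum_n v n)).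
    { induction i as [|i IH].
      - rewrite Nat.add_0_r. lra.
      - rewrite <- plus_n_Sm, !sum_n_S.
        assert (A (S (n + i)) * t ^ e (S (n + i)) <= t / X * v (S (n + i))).
        { set (j := S (n + i)). unfold v.
          apply Rle_trans with (Rabs (A j) * t ^ e j).
          - apply Rmult_le_compat_r; [apply pow_le; lra|apply Rle_abs].
          - replace (t / X * (Rabs (A j) * X ^ e j))
              with (Rabs (A j) * (t / X * X ^ e j)) by ring.
            apply Rmult_le_compat_l; [apply Rabs_pos|].
            replace (t ^ e j) with ((t / X) ^ e j * X ^ e j).
            2:{ rewrite <- Rpow_mult_distr. f_equal. field; lra. }
            apply Rmult_le_compat_r; [apply pow_le; lra|].
            rewrite <- (pow_1 (t / X)) at 2. apply pow_anti; [lra|apply He]. }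
        lra. }
    specialize (Hd N'). specialize (Hvs (n + N')%nat).
    assert (t / X * (sum_n v (n + N') - sum_n v n) <= t / X * tau)
      by (apply Rmult_le_compat_l; lra).
    lra. }
  (* The derivative of [f] is [1 / t] times the partial sum plus its error allowance, which [HP]
     makes nonnegative. As [f 0 = 0], the mean value theorem gives [f X >= 0], that is, a partial
     sum of at least [- tau]. *)
  set (f := fun t => sum_n (fun k => A k / INR (e k) * t ^ e k) n + tau / X * t).
  set (f' := fun t => sum_n (fun k => A k * t ^ pred (e k)) n + tau / X * 1).
  assert (HeR : forall k, INR (e k) <> 0) by (intros k; apply not_0_INR; specialize (He k); lia).
  destruct (MVT_cor2 f f' 0 X) as [c [Hc1 Hc2]]; [lra| |].
  { intros c _. unfold f, f'. apply derivable_pt_lim_plus.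
    - apply (derivable_pt_lim_sum_n (fun k t => A k / INR (e k) * t ^ e k)
               (fun k t => A k * t ^ pred (e k))).
      intros k. replace (A k * c ^ pred (e k))
        with (A k / INR (e k) * (INR (e k) * c ^ pred (e k))) by (field; apply HeR).
      apply derivable_pt_lim_scal, derivable_pt_lim_pow.
    - apply derivable_pt_lim_scal, derivable_pt_lim_id. }
  assert (Hf0 : f 0 = 0).
  { unfold f. rewrite (sum_n_Rext _ (fun _ => 0 * 0)).
    - rewrite sum_n_scal. ring.
    - intros k. rewrite pow_ne_zero by (specialize (He k); lia). ring. }
  assert (Hf' : 0 <= f' c).
  { apply (Rmult_le_reg_l c); [lra|]. unfold f'.
    rewrite Rmult_0_r, Rmult_plus_distr_l, <- sum_n_scal.
    rewrite (sum_n_Rext _ (fun k => A k * c ^ e k)).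
    - specialize (HP c Hc2).
      replace (c * (tau / X * 1)) with (tau * (c / X)) by (field; lra). lra.
    - intros k. specialize (He k). destruct (e k) as [|i]; [lia|]. simpl. ring. }
  assert (Hf : 0 <= f X) by (rewrite Hf0 in Hc1; nra).
  unfold f in Hf. replace (tau / X * X) with tau in Hf by (field; lra). lra.
Qed.

Lemma ex_series_square (v : nat -> R) :
  (forall k, 0 <= v k) -> ex_series v -> ex_series (fun k => v k ^ 2).
Proof.
  intros Hv [s Sv].
  apply (ex_series_le_R _ (fun k => s * v k)).
  - intros k. split; [apply pow2_ge_0|].
    assert (v k <= s).
    { eapply Rle_trans; [|apply (sum_n_le_series v s Hv Sv k)].
      destruct k as [|k]; [rewrite sum_O; lra|]. rewrite sum_n_S.
      assert (0 <= sum_n v k) by (apply sum_n_nonneg; auto). lra. }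
    specialize (Hv k). nra.
  - apply ex_series_scal_R. exists s; exact Sv.
Qed.

Lemma ex_series_plus_R (u v : nat -> R) :
  ex_series u -> ex_series v -> ex_series (fun k => u k + v k).
Proof. exact (ex_series_plus (V := R_NormedModule) u v). Qed.

Lemma pow_sqrt_even (x : R) (n : nat) : 0 <= x -> (sqrt x ^ n) ^ 2 = x ^ n.
Proof.
  intros Hx. rewrite <- pow_mult, Nat.mul_comm, pow_mult, pow2_sqrt by exact Hx.
  reflexivity.
Qed.

(** On the circle of radius [sqrt x], which avoids 0, Parseval for the derivatives carries the
    powers [x ^ (p * k + m)] and the weights [e^2]. One more factor [x] restores the exponent [e],
    so that each division by [e] keeps the form of the series. *)
Lemma dilatation_coefficients (p m : nat) (a b : nat -> C) (h g : C -> C) (d : R) :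
  (1 <= p)%nat -> has_expansion p (S m) a h -> has_expansion p (S m) b g -> 0 <= d ->
  (forall z, in_disc z -> z <> 0 -> Cmod (C_derive g z) <= d * Cmod (C_derive h z)) ->
  forall x, 0 < x < 1 ->
  eventually_nonneg_sums
    (fun k => (d ^ 2 * Cmod (a k) ^ 2 - Cmod (b k) ^ 2) * x ^ (p * k + S m)).
Proof.
  intros Hp Ha Hb Hd Hgh.
  set (e := fun k => (p * k + S m)%nat).
  set (D := fun k => d ^ 2 * Cmod (a k) ^ 2 - Cmod (b k) ^ 2).
  assert (He : forall k, (1 <= e k)%nat) by (intros k; unfold e; lia).
  assert (HeR : forall k, 1 <= INR (e k)) by (intros k; apply (le_INR 1), He).
  assert (Hsum : forall x, 0 < x < 1 ->
    ex_series (fun k => INR (e k) ^ 2 * Rabs (D k) * x ^ e k)).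
  { intros x Hx.
    assert (Hq : 0 <= sqrt x < 1).
    { split; [apply sqrt_pos|]. rewrite <- sqrt_1. apply sqrt_lt_1; lra. }
    pose proof (abs_summable_mul _ _ _ (has_expansion_abs_summable _ _ _ _ Hp Ha) _ Hq) as Sa.
    pose proof (abs_summable_mul _ _ _ (has_expansion_abs_summable _ _ _ _ Hp Hb) _ Hq) as Sb.
    assert (Hpos : forall c : nat -> C, forall k,
      0 <= Cmod (INR (p * k + S m) * c k) * sqrt x ^ (p * k + S m)).
    { intros c k. apply Rmult_le_pos; [apply Cmod_ge_0|apply pow_le; lra]. }
    pose proof (ex_series_plus_R _ _
      (ex_series_scal_R (d ^ 2) _ (ex_series_square _ (Hpos a) Sa))
      (ex_series_square _ (Hpos b) Sb)) as Sab.
    revert Sab. apply ex_series_le_R. intros k.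
    rewrite !Rpow_mult_distr, pow_sqrt_even by lra.
    rewrite !Cmod_mult, !Cmod_R, !(Rabs_pos_eq _ (pos_INR _)), !Rpow_mult_distr.
    fold (e k).
    assert (Hxe : 0 <= x ^ e k) by (apply pow_le; lra).
    split.
    - apply Rmult_le_pos; [|exact Hxe].
      apply Rmult_le_pos; [apply pow2_ge_0|apply Rabs_pos].
    - replace (d ^ 2 * (INR (e k) ^ 2 * Cmod (a k) ^ 2 * x ^ e k)
        + INR (e k) ^ 2 * Cmod (b k) ^ 2 * x ^ e k)
        with (INR (e k) ^ 2 * (d ^ 2 * Cmod (a k) ^ 2 + Cmod (b k) ^ 2) * x ^ e k) by ring.
      apply Rmult_le_compat_r; [exact Hxe|].
      apply Rmult_le_compat_l; [apply pow2_ge_0|].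
      pose proof (Rmult_le_pos _ _ (pow2_ge_0 d) (pow2_ge_0 (Cmod (a k)))).
      pose proof (pow2_ge_0 (Cmod (b k))).
      unfold D. apply Rabs_le. lra. }
  assert (Hnn : forall x, 0 < x < 1 ->
    eventually_nonneg_sums (fun k => INR (e k) ^ 2 * D k * x ^ e k)).
  { intros x Hx eps Heps.
    assert (Hq : 0 < sqrt x < 1).
    { split; [apply sqrt_lt_R0; lra|]. rewrite <- sqrt_1. apply sqrt_lt_1; lra. }
    destruct (parseval_comparison p m m _ _ _ _ (sqrt x) Hp
      (has_expansion_C_derive _ _ _ _ Hp Hb)
      (has_expansion_scal _ _ d _ _ (has_expansion_C_derive _ _ _ _ Hp Ha)) Hq)
      with (eps := eps) as [N HN]; [|exact Heps|].
    - intros z Hz. rewrite Cmod_mult, Cmod_R, (Rabs_pos_eq d Hd).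
      apply Hgh; [unfold in_disc; lra|].
      intros ->. rewrite Cmod_0 in Hz. lra.
    - exists N. intros n Hn. specialize (HN n Hn).
      rewrite (sum_n_Rext _ (fun k =>
        x * ((Cmod (d * (INR (p * k + S m) * a k)) ^ 2 * (sqrt x ^ (p * k + m)) ^ 2)
         + (-1) * (Cmod (INR (p * k + S m) * b k) ^ 2 * (sqrt x ^ (p * k + m)) ^ 2)))).
      + rewrite sum_n_scal, sum_n_add, sum_n_scal.
        match type of HN with ?u <= ?v + _ =>
          assert (Hle : - eps <= v + -1 * u) by lra end.
        nra.
      + intros k. rewrite pow_sqrt_even by lra. unfold D.
        rewrite !Cmod_mult, !Cmod_R, !(Rabs_pos_eq _ (pos_INR _)), (Rabs_pos_eq d Hd).
        rewrite !Rpow_mult_distr. unfold e. rewrite <- plus_n_Sm. simpl. ring. }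
  assert (HR1 : forall x, 0 < x < 1 ->
    ex_series (fun k => Rabs (INR (e k) ^ 2 * D k) * x ^ e k)).
  { intros x Hx. generalize (Hsum x Hx). apply ex_series_ext. intros k.
    rewrite Rabs_mult, (Rabs_pos_eq (INR (e k) ^ 2)) by apply pow2_ge_0. reflexivity. }
  pose proof (eventually_nonneg_sums_div e _ He HR1 Hnn) as H1.
  assert (HR2 : forall x, 0 < x < 1 ->
    ex_series (fun k => Rabs (INR (e k) ^ 2 * D k / INR (e k)) * x ^ e k)).
  { intros x Hx. generalize (HR1 x Hx). apply ex_series_le_R. intros k.
    assert (Hxe : 0 <= x ^ e k) by (apply pow_le; lra).
    split; [apply Rmult_le_pos; [apply Rabs_pos|exact Hxe]|].
    apply Rmult_le_compat_r; [exact Hxe|].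
    specialize (HeR k). unfold Rdiv. rewrite Rabs_mult, Rabs_inv.
    rewrite (Rabs_pos_eq (INR (e k))) by lra.
    rewrite <- (Rmult_1_r (Rabs (INR (e k) ^ 2 * D k))) at 2.
    apply Rmult_le_compat_l; [apply Rabs_pos|].
    rewrite <- Rinv_1. apply Rinv_le_contravar; lra. }
  pose proof (eventually_nonneg_sums_div e _ He HR2 H1) as H2.
  intros x Hx eps Heps. destruct (H2 x Hx eps Heps) as [N HN].
  exists N. intros n Hn. specialize (HN n Hn).
  rewrite (sum_n_Rext _ (fun k => INR (e k) ^ 2 * D k / INR (e k) / INR (e k) * x ^ e k)).
  - exact HN.
  - intros k. unfold D, e in *. specialize (HeR k). field. lra.
Qed.

Lemma exists_root (p : nat) (rho : R) :
  (1 <= p)%nat -> 0 < rho < 1 -> exists x, 0 < x < 1 /\ x ^ p = rho.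
Proof.
  intros Hp Hr. exists (Rpower rho (/ INR p)).
  assert (HpR : 0 < INR p) by (apply lt_0_INR; lia).
  assert (Hx : 0 < Rpower rho (/ INR p)) by apply exp_pos.
  split; [split; [exact Hx|]|].
  - unfold Rpower. rewrite <- exp_0. apply exp_increasing.
    assert (ln rho < 0) by (rewrite <- ln_1; apply ln_increasing; lra).
    assert (0 < / INR p) by (apply Rinv_0_lt_compat; exact HpR). nra.
  - rewrite <- Rpower_pow by exact Hx. rewrite Rpower_mult, Rinv_l by lra.
    apply Rpower_1; lra.
Qed.

(** After [rho = x ^ p] and division by [x ^ m], the terms of index 0 combine to
    [(d^2 - 1) u_0 <= 0], thanks to [w_0 = u_0] and [d <= 1]. Hence the tail of [w] is at most [d^2]
    times the tail of [u], up to [eps]. *)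
Lemma dilatation_tail_bound (p m : nat) (u w : nat -> R) (d rho : R) (n : nat) :
  (1 <= p)%nat -> (forall k, 0 <= u k) -> (forall k, 0 <= w k) -> 0 <= d <= 1 ->
  (forall l, sum_n u l <= 1) ->
  (forall l, u (S l) <= (1 - u 0%nat) * (1 - sum_n u l)) ->
  w 0%nat = u 0%nat ->
  (forall x, 0 < x < 1 ->
     eventually_nonneg_sums (fun k => (d ^ 2 * u k - w k) * x ^ (p * k + m))) ->
  0 < rho <= 1 ->
  sum_n (fun k => w (S k) * rho ^ S k) n * (1 - u 0%nat * rho)
  <= d ^ 2 * (rho * (1 - u 0%nat) ^ 2).
Proof.
  intros Hp Hu Hw Hd Hu1 HuS Hw0 Hnn Hrho.
  assert (Hv : 0 <= u 0%nat <= 1).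
  { split; [apply Hu|]. specialize (Hu1 0%nat). rewrite sum_O in Hu1. exact Hu1. }
  assert (Hlt : forall rho, 0 < rho < 1 ->
    sum_n (fun k => w (S k) * rho ^ S k) n * (1 - u 0%nat * rho)
    <= d ^ 2 * (rho * (1 - u 0%nat) ^ 2)).
  { clear rho Hrho. intros rho Hrho.
    destruct (exists_root p rho Hp Hrho) as [x [Hx Hxp]].
    apply le_epsilon. intros eps Heps.
    assert (Hxm : 0 < x ^ m) by (apply pow_lt; lra).
    destruct (Hnn x Hx (eps * x ^ m) ltac:(nra)) as [N HN].
    specialize (HN (S (N + n))%nat ltac:(lia)).
    set (W := fun j => sum_n (fun k => w (S k) * rho ^ S k) j).
    set (U := fun j => sum_n (fun k => u (S k) * rho ^ S k) j).
    assert (Hsplit : forall j,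
      sum_n (fun k => (d ^ 2 * u k - w k) * x ^ (p * k + m)) (S j)
      = x ^ m * ((d ^ 2 - 1) * u 0%nat + d ^ 2 * U j - W j) :> R).
    { assert (Hpow : forall k, x ^ (p * k + m) = x ^ m * rho ^ k).
      { intros k. rewrite pow_add, pow_mult, Hxp. ring. }
      induction j as [|j IH].
      - rewrite sum_n_S. unfold U, W. rewrite !sum_O, !Hpow, Hw0. simpl. ring.
      - rewrite sum_n_S, IH, Hpow. unfold U, W. rewrite !sum_n_S. ring. }
    rewrite Hsplit in HN.
    assert (HN' : - eps <= (d ^ 2 - 1) * u 0%nat + d ^ 2 * U (N + n)%nat - W (N + n)%nat).
    { apply (Rmult_le_reg_l (x ^ m)); [exact Hxm|]. lra. }
    pose proof (weighted_tail_bound u rho (N + n) Hu Hu1 HuS ltac:(lra)) as HT.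
    change (U (N + n)%nat * (1 - u 0%nat * rho) <= rho * (1 - u 0%nat) ^ 2) in HT.
    change (W n * (1 - u 0%nat * rho) <= d ^ 2 * (rho * (1 - u 0%nat) ^ 2) + eps).
    assert (HWn : W n <= W (N + n)%nat).
    { apply sum_n_incr; [|lia]. intros k.
      apply Rmult_le_pos; [apply Hw|apply pow_le; lra]. }
    assert (Hd2 : 0 <= d ^ 2 <= 1) by nra.
    assert (Hk : 0 <= 1 - u 0%nat * rho <= 1) by nra.
    assert (W n <= d ^ 2 * U (N + n)%nat + eps) by nra.
    apply Rle_trans with ((d ^ 2 * U (N + n)%nat + eps) * (1 - u 0%nat * rho)).
    - apply Rmult_le_compat_r; lra.
    - assert (d ^ 2 * (U (N + n)%nat * (1 - u 0%nat * rho))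
              <= d ^ 2 * (rho * (1 - u 0%nat) ^ 2))
        by (apply Rmult_le_compat_l; lra).
      nra. }
  (* The weight [rho = 1] is needed when [|a_0|] is small; it is reached by continuity because [n]
     is fixed. *)
  destruct (Req_dec rho 1) as [->|Hne]; [|apply Hlt; lra].
  set (f := fun t => sum_n (fun k => w (S k) * t ^ S k) n * (1 - u 0%nat * t)
                     - d ^ 2 * (t * (1 - u 0%nat) ^ 2)).
  enough (f 1 <= 0) by (unfold f in *; lra).
  apply le_at_1_of_continuous.
  - unfold f. apply continuity_pt_minus.
    + apply continuity_pt_mult.
      * apply continuity_pt_sum_n. intros k. apply continuity_pt_monomial.
      * apply derivable_continuous_pt. reg.
    + apply derivable_continuous_pt. reg.
  - intros t Ht. specialize (Hlt t Ht). unfold f. lra.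
Qed.

(** * Bounds for the majorant series *)

Lemma sum_n_cauchy_schwarz (u v : nat -> R) (n : nat) :
  sum_n (fun k => u k * v k) n ^ 2
  <= sum_n (fun k => u k ^ 2) n * sum_n (fun k => v k ^ 2) n.
Proof.
  induction n as [|n IH].
  - rewrite !sum_O. apply Req_le. R_ring.
  - rewrite !sum_n_S.
    set (P := sum_n (fun k => u k * v k) n) in *.
    set (F := sum_n (fun k => u k ^ 2) n) in *.
    set (G := sum_n (fun k => v k ^ 2) n) in *.
    assert (HF : 0 <= F) by (apply sum_n_nonneg; intros; apply pow2_ge_0).
    assert (HG : 0 <= G) by (apply sum_n_nonneg; intros; apply pow2_ge_0).
    set (x := u (S n)). set (y := v (S n)).
    (* By squares: [4 P^2 (x y)^2 <= 4 (F y^2) (G x^2) <= (F y^2 + G x^2)^2]. *)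
    assert (Hc : 2 * P * (x * y) <= F * y ^ 2 + G * x ^ 2).
    { assert (HFG : 0 <= F * y ^ 2 + G * x ^ 2).
      { apply Rplus_le_le_0_compat; apply Rmult_le_pos; try assumption; apply pow2_ge_0. }
      apply Rsqr_incr_0_var; [|exact HFG]. unfold Rsqr.
      pose proof (pow2_ge_0 (F * y ^ 2 - G * x ^ 2)).
      pose proof (Rmult_le_compat_r _ _ _ (pow2_ge_0 (x * y)) IH). nra. }
    nra.
Qed.

Lemma sum_n_geom_le (q : R) (n : nat) :
  0 <= q < 1 -> sum_n (fun k => q ^ S k) n <= q / (1 - q).
Proof.
  intros Hq.
  assert (H : sum_n (fun k => q ^ S k) n * (1 - q) = q - q ^ S (S n)).
  { induction n as [|n IH].
    - rewrite sum_O. simpl. R_ring.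
    - rewrite sum_n_S, Rmult_plus_distr_r, IH. simpl. ring. }
  apply (Rmult_le_reg_r (1 - q)); [lra|]. rewrite H.
  replace (q / (1 - q) * (1 - q)) with q by (field; lra).
  assert (0 <= q ^ S (S n)) by (apply pow_le; lra). lra.
Qed.

(** Each [s ^ k] splits as [sqrt rho ^ k * (s / sqrt rho) ^ k]; the squares of the second factors
    form a geometric series, which converges because [s ^ 2 < rho]. *)
Lemma tail_sum_cauchy_schwarz (x : nat -> R) (s rho K : R) (n : nat) :
  0 < s -> s ^ 2 < rho -> 0 <= K ->
  sum_n (fun k => x (S k) ^ 2 * rho ^ S k) n <= K ->
  sum_n (fun k => x (S k) * s ^ S k) n ^ 2 <= K * (s ^ 2 / (rho - s ^ 2)).
Proof.
  intros Hs Hrho HK HT.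
  assert (Hr0 : 0 < rho) by nra.
  assert (Hq0 : 0 < sqrt rho) by (apply sqrt_lt_R0; exact Hr0).
  pose proof (sum_n_cauchy_schwarz (fun k => x (S k) * sqrt rho ^ S k)
                (fun k => (s / sqrt rho) ^ S k) n) as CS.
  rewrite (sum_n_Rext _ (fun k => x (S k) * s ^ S k)) in CS.
  2:{ intros k. rewrite Rmult_assoc, <- Rpow_mult_distr. do 2 f_equal. field; lra. }
  rewrite (sum_n_Rext (fun k => (x (S k) * sqrt rho ^ S k) ^ 2)
             (fun k => x (S k) ^ 2 * rho ^ S k)) in CS.
  2:{ intros k. rewrite Rpow_mult_distr, pow_sqrt_even by lra. reflexivity. }
  rewrite (sum_n_Rext (fun k => ((s / sqrt rho) ^ S k) ^ 2)
             (fun k => (s ^ 2 / rho) ^ S k)) in CS.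
  2:{ intros k. rewrite <- pow_mult, Nat.mul_comm, pow_mult. f_equal.
      unfold Rdiv. rewrite Rpow_mult_distr, pow_inv, pow2_sqrt by lra. reflexivity. }
  assert (Hq : 0 <= s ^ 2 / rho < 1).
  { split; [apply Rdiv_le_0_compat; [apply pow2_ge_0|exact Hr0]|].
    apply (Rmult_lt_reg_r rho); [exact Hr0|]. field_simplify; lra. }
  pose proof (sum_n_geom_le (s ^ 2 / rho) n Hq) as HG.
  eapply Rle_trans; [exact CS|].
  replace (s ^ 2 / (rho - s ^ 2)) with (s ^ 2 / rho / (1 - s ^ 2 / rho)) by (field; lra).
  apply Rmult_le_compat; try assumption.
  - apply sum_n_nonneg. intros k _.
    apply Rmult_le_pos; [apply pow2_ge_0|apply pow_le; lra].
  - apply sum_n_nonneg. intros k _. apply pow_le; lra.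
Qed.

Lemma le_of_sqr_le (x y : R) : 0 <= y -> x ^ 2 <= y ^ 2 -> x <= y.
Proof.
  intros Hy H. apply Rsqr_incr_0_var; [|exact Hy]. unfold Rsqr. lra.
Qed.

(** For [c = 1] the bound is the value at [s] of the majorant tail of the Blaschke factor with zero
    [a], whose coefficients make Cauchy-Schwarz an equality at this [rho]. The constant [c] is 1 for
    [h] and [d] for [g]. *)
Lemma tail_sum_large (x : nat -> R) (c a s : R) (n : nat) :
  0 <= c -> 0 < s < 1 -> s <= a <= 1 ->
  (forall rho, 0 < rho <= 1 ->
     sum_n (fun k => x (S k) ^ 2 * rho ^ S k) n * (1 - a ^ 2 * rho)
     <= c ^ 2 * (rho * (1 - a ^ 2) ^ 2)) ->
  sum_n (fun k => x (S k) * s ^ S k) n <= c * (s * (1 - a ^ 2) / (1 - a * s)).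
Proof.
  intros Hc Hs Ha H.
  assert (Has : 0 < a * s < 1) by nra.
  (* this [rho] maximizes [(1 - a^2 rho) (1 - s^2 / rho)] *)
  set (rho := s / a).
  assert (Hrho : 0 < rho <= 1).
  { unfold rho. split; [apply Rdiv_lt_0_compat; lra|].
    apply (Rmult_le_reg_r a); [lra|]. field_simplify; lra. }
  assert (Har : a ^ 2 * rho = a * s) by (unfold rho; field; lra).
  assert (Hrs : rho - s ^ 2 = rho * (1 - a * s)) by (unfold rho; field; lra).
  specialize (H rho Hrho). rewrite Har in H.
  apply le_of_sqr_le.
  { apply Rmult_le_pos; [exact Hc|]. apply Rdiv_le_0_compat; [|lra].
    apply Rmult_le_pos; nra. }
  eapply Rle_trans.
  - apply (tail_sum_cauchy_schwarz x s rho
             (c ^ 2 * (rho * (1 - a ^ 2) ^ 2) / (1 - a * s))).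
    + lra.
    + assert (0 < rho * (1 - a * s)) by (apply Rmult_lt_0_compat; lra). lra.
    + apply Rdiv_le_0_compat; [|lra].
      apply Rmult_le_pos; [apply pow2_ge_0|].
      apply Rmult_le_pos; [lra|apply pow2_ge_0].
    + apply (Rmult_le_reg_r (1 - a * s)); [lra|].
      eapply Rle_trans; [exact H|]. apply Req_le. field; lra.
  - rewrite Hrs. apply Req_le. field; lra.
Qed.

(** Meant for [a < s], where the optimal [s / a] would exceed 1, so [rho = 1] is taken. The
    resulting root of [(1 - a^2) (1 - s^2)] is replaced by the arithmetic mean, which is exact at
    [a = s] and agrees there with [tail_sum_large]. *)
Lemma tail_sum_small (x : nat -> R) (c a s : R) (n : nat) :
  0 <= c -> 0 < s < 1 -> 0 <= a < 1 ->
  (forall rho, 0 < rho <= 1 ->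
     sum_n (fun k => x (S k) ^ 2 * rho ^ S k) n * (1 - a ^ 2 * rho)
     <= c ^ 2 * (rho * (1 - a ^ 2) ^ 2)) ->
  sum_n (fun k => x (S k) * s ^ S k) n
  <= c * (s * (2 - a ^ 2 - s ^ 2) / (2 * (1 - s ^ 2))).
Proof.
  intros Hc Hs Ha H.
  specialize (H 1 ltac:(lra)). rewrite Rmult_1_r, Rmult_1_l in H.
  assert (Ha2 : 0 < 1 - a ^ 2) by nra.
  assert (Hs2 : 0 < 1 - s ^ 2) by nra.
  apply le_of_sqr_le.
  { apply Rmult_le_pos; [exact Hc|]. apply Rdiv_le_0_compat; [|lra].
    apply Rmult_le_pos; lra. }
  eapply Rle_trans.
  - apply (tail_sum_cauchy_schwarz x s 1 (c ^ 2 * (1 - a ^ 2))); try lra.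
    + apply Rmult_le_pos; [apply pow2_ge_0|lra].
    + apply (Rmult_le_reg_r (1 - a ^ 2)); [lra|]. lra.
  - rewrite Rpow_mult_distr, Rmult_assoc.
    apply Rmult_le_compat_l; [apply pow2_ge_0|].
    replace ((s * (2 - a ^ 2 - s ^ 2) / (2 * (1 - s ^ 2))) ^ 2)
      with (s ^ 2 * ((2 - a ^ 2 - s ^ 2) ^ 2 / 4) / (1 - s ^ 2) ^ 2) by (field; lra).
    replace ((1 - a ^ 2) * (s ^ 2 / (1 - s ^ 2)))
      with (s ^ 2 * ((1 - a ^ 2) * (1 - s ^ 2)) / (1 - s ^ 2) ^ 2) by (field; lra).
    apply Rmult_le_compat_r.
    + left. apply Rinv_0_lt_compat, pow_lt; lra.
    + apply Rmult_le_compat_l; [apply pow2_ge_0|].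
      pose proof (pow2_ge_0 ((1 - a ^ 2) - (1 - s ^ 2))). nra.
Qed.

Lemma C_derive_n_leading (p m : nat) (a b : nat -> C) (h g : C -> C) :
  (1 <= p)%nat -> has_expansion p m a h -> has_expansion p m b g ->
  Cmod (C_derive_n h m 0) = Cmod (C_derive_n g m 0) <->
  Cmod (a 0%nat) = Cmod (b 0%nat).
Proof.
  intros Hp Ha Hb.
  rewrite (C_derive_n_at_0 p m a h Hp Ha), (C_derive_n_at_0 p m b g Hp Hb).
  rewrite !Cmod_mult, !Cmod_R, !(Rabs_pos_eq _ (pos_INR _)).
  assert (Hf : 0 < INR (fact m)) by apply INR_fact_lt_0.
  split; [|intros ->; reflexivity].
  intros E. apply (Rmult_eq_reg_l (INR (fact m))); [exact E|lra].
Qed.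

(** [M] is any positive bound of [h] rather than its supremum, so that coefficients can be divided
    by [M] even for [h = 0]. *)
Lemma partial_sum_bound (p m : nat) (d : R) (a b : nat -> C) (f h g : C -> C)
    (M r : R) (n : nat) :
  (1 <= m)%nat -> (1 <= p)%nat -> 0 <= d <= 1 -> admissible p m d a b f h g ->
  0 < M -> (forall z, in_disc z -> Cmod (h z) <= M) ->
  0 < r < 1 -> (r ^ p) ^ 2 <= 1 / 2 ->
  (forall t, r ^ p <= t <= 1 ->
     r ^ m * (2 * t + (1 + d) * (r ^ p * (1 - t ^ 2) / (1 - t * r ^ p))) <= 1) ->
  sum_n (fun k => (Cmod (a k) + Cmod (b k)) * r ^ (p * k + m)) n <= M.
Proof.
  intros Hm Hp Hd [[_ [_ [_ [Ea Eb]]]] [Hlead [Hdil _]]] HM Hb Hr Hs2 HF.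
  destruct m as [|m]; [lia|].
  apply (C_derive_n_leading p (S m) a b h g Hp Ea Eb) in Hlead.
  set (x := fun k => Cmod (a k) / M). set (y := fun k => Cmod (b k) / M).
  assert (HM2 : 0 < M ^ 2) by (apply pow_lt; exact HM).
  assert (Hxsum : forall l, sum_n (fun k => x k ^ 2) l
                   = / M ^ 2 * sum_n (fun k => Cmod (a k) ^ 2) l :> R).
  { intros l. rewrite <- sum_n_scal. apply sum_n_Rext. intros k. unfold x. field. lra. }
  assert (Hx1 : forall l, sum_n (fun k => x k ^ 2) l <= 1).
  { intros l. rewrite Hxsum.
    destruct (bounded_coefficients p (S m) l a h M Hp Ea ltac:(lra) Hb) as [H _].
    apply (Rmult_le_reg_l (M ^ 2)); [exact HM2|].
    rewrite <- Rmult_assoc, Rinv_r by lra. lra. }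
  assert (HxS : forall l, x (S l) ^ 2
                 <= (1 - x 0%nat ^ 2) * (1 - sum_n (fun k => x k ^ 2) l)).
  { intros l. rewrite Hxsum.
    destruct (bounded_coefficients p (S m) l a h M Hp Ea ltac:(lra) Hb) as [_ H].
    set (A := sum_n (fun k => Cmod (a k) ^ 2) l) in *.
    apply (Rmult_le_reg_l (M ^ 2 * M ^ 2)); [nra|].
    replace (M ^ 2 * M ^ 2 * x (S l) ^ 2) with (M ^ 2 * Cmod (a (S l)) ^ 2)
      by (unfold x; field; lra).
    replace (M ^ 2 * M ^ 2 * ((1 - x 0%nat ^ 2) * (1 - / M ^ 2 * A)))
      with ((M ^ 2 - Cmod (a 0%nat) ^ 2) * (M ^ 2 - A))
      by (unfold x; field; lra).
    exact H. }
  set (alpha := x 0%nat) in *.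
  assert (Ha0 : 0 <= alpha <= 1).
  { assert (0 <= alpha) by (apply Rdiv_le_0_compat; [apply Cmod_ge_0|exact HM]).
    specialize (Hx1 0%nat). rewrite sum_O in Hx1. fold alpha in Hx1. split; [lra|nra]. }
  assert (Hy0 : y 0%nat = alpha) by (unfold alpha, x, y; rewrite Hlead; reflexivity).
  assert (HX : forall rho, 0 < rho <= 1 ->
     sum_n (fun k => x (S k) ^ 2 * rho ^ S k) n * (1 - alpha ^ 2 * rho)
     <= 1 ^ 2 * (rho * (1 - alpha ^ 2) ^ 2)).
  { intros rho Hrho. rewrite pow1, Rmult_1_l.
    apply (weighted_tail_bound (fun k => x k ^ 2)); try assumption.
    - intros k; apply pow2_ge_0.
    - lra. }
  assert (HY : forall rho, 0 < rho <= 1 ->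
     sum_n (fun k => y (S k) ^ 2 * rho ^ S k) n * (1 - alpha ^ 2 * rho)
     <= d ^ 2 * (rho * (1 - alpha ^ 2) ^ 2)).
  { intros rho Hrho.
    apply (dilatation_tail_bound p (S m) (fun k => x k ^ 2) (fun k => y k ^ 2)); try assumption.
    - intros k; apply pow2_ge_0.
    - intros k; apply pow2_ge_0.
    - fold alpha. rewrite Hy0. reflexivity.
    - intros z Hz eps Heps.
      destruct (dilatation_coefficients p m a b h g d Hp Ea Eb (proj1 Hd) Hdil z Hz
                  (M ^ 2 * eps)) as [N HN]; [nra|].
      exists N. intros i Hi. specialize (HN i Hi).
      rewrite (sum_n_Rext _ (fun k => / M ^ 2 *
        ((d ^ 2 * Cmod (a k) ^ 2 - Cmod (b k) ^ 2) * z ^ (p * k + S m)))).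
      + rewrite sum_n_scal. apply (Rmult_le_reg_l (M ^ 2)); [exact HM2|].
        rewrite <- Rmult_assoc, Rinv_r by lra. lra.
      + intros k. unfold x, y. field. lra. }
  set (s := r ^ p) in *.
  assert (Hs : 0 < s < 1).
  { unfold s. split; [apply pow_lt; lra|].
    apply pow_lt_1_compat; [lra|lia]. }
  assert (Hrm : 0 < r ^ S m) by (apply pow_lt; lra).
  (* A single [B] serves both tails, with factors 1 and [d]; their sum produces the factor
     [1 + d]. *)
  assert (Hsum : exists B,
    sum_n (fun k => x (S k) * s ^ S k) n <= 1 * B /\
    sum_n (fun k => y (S k) * s ^ S k) n <= d * B /\
    r ^ S m * (2 * alpha + (1 + d) * B) <= 1).
  { destruct (Rle_lt_dec s alpha) as [Hcase|Hcase].
    - exists (s * (1 - alpha ^ 2) / (1 - alpha * s)). repeat split.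
      + apply tail_sum_large; try lra. exact HX.
      + apply tail_sum_large; try lra. exact HY.
      + apply HF. lra.
    - exists (s * (2 - alpha ^ 2 - s ^ 2) / (2 * (1 - s ^ 2))). repeat split.
      + apply tail_sum_small; try lra. exact HX.
      + apply tail_sum_small; try lra. exact HY.
      + specialize (HF s ltac:(lra)).
        assert (Hs2' : 1 / 2 <= 1 - s ^ 2) by lra.
        replace (s * (1 - s ^ 2) / (1 - s * s)) with s in HF by (field; lra).
        eapply Rle_trans; [|exact HF].
        apply Rmult_le_compat_l; [lra|].
        (* the bound increases in [alpha] up to the value [2 s + (1 + d) s] at [s] *)
        set (B := s * (2 - alpha ^ 2 - s ^ 2) / (2 * (1 - s ^ 2))).
        assert (HB : (B - s) * (2 * (1 - s ^ 2)) = s * (s - alpha) * (s + alpha))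
          by (unfold B; field; lra).
        (* Here [s ^ 2 <= 1 / 2] enters, through [s (s + alpha) <= 1 <= 2 (1 - s^2)]. As
           [1 + d <= 2], the gain [(1 + d) (B - s)] is then covered by [2 (s - alpha)]. *)
        assert (HB' : B - s <= s - alpha).
        { apply (Rmult_le_reg_r (2 * (1 - s ^ 2))); [lra|]. rewrite HB.
          assert (s * (s + alpha) <= 1) by nra.
          assert (0 <= (s - alpha) * (1 - s * (s + alpha))) by (apply Rmult_le_pos; lra).
          nra. }
        assert (HB0 : 0 <= B - s).
        { apply (Rmult_le_reg_r (2 * (1 - s ^ 2))); [lra|]. rewrite HB, Rmult_0_l.
          apply Rmult_le_pos; [apply Rmult_le_pos|]; lra. }
        nra. }
  destruct Hsum as [B [HBx [HBy HB]]].
  assert (Hsplit : forall j,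
    sum_n (fun k => (Cmod (a k) + Cmod (b k)) * r ^ (p * k + S m)) (S j)
    = M * (r ^ S m * (2 * alpha + (sum_n (fun k => x (S k) * s ^ S k) j
                     + sum_n (fun k => y (S k) * s ^ S k) j))) :> R).
  { assert (Hpow : forall k, r ^ (p * k + S m) = r ^ S m * s ^ k).
    { intros k. unfold s. rewrite pow_add, pow_mult. ring. }
    assert (Hxa : forall k, Cmod (a k) = M * x k) by (intros; unfold x; field; lra).
    assert (Hyb : forall k, Cmod (b k) = M * y k) by (intros; unfold y; field; lra).
    induction j as [|i IH].
    - rewrite sum_n_S, !sum_O, !Hpow, !Hxa, !Hyb, Hy0. fold alpha. simpl. R_ring.
    - rewrite sum_n_S, IH, Hpow, Hxa, Hyb, !(sum_n_S (fun k => _ * s ^ S k)). ring. }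
  eapply Rle_trans; [apply (sum_n_incr _ n (S n)); [|lia]|].
  - intros k. apply Rmult_le_pos; [|apply pow_le; lra].
    apply Rplus_le_le_0_compat; apply Cmod_ge_0.
  - rewrite Hsplit. rewrite <- (Rmult_1_r M) at 2.
    apply Rmult_le_compat_l; [lra|]. eapply Rle_trans; [|exact HB].
    apply Rmult_le_compat_l; [lra|]. lra.
Qed.

Lemma B_H_le_sup_norm (p m : nat) (d : R) (a b : nat -> C) (f h g : C -> C) (r0 : R) :
  (1 <= m)%nat -> (1 <= p)%nat -> 0 <= d <= 1 -> admissible p m d a b f h g ->
  0 < r0 < 1 -> (r0 ^ p) ^ 2 <= 1 / 2 ->
  (forall t, r0 ^ p <= t <= 1 ->
     r0 ^ m * (2 * t + (1 + d) * (r0 ^ p * (1 - t ^ 2) / (1 - t * r0 ^ p))) <= 1) ->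
  forall r, 0 <= r <= r0 -> Rbar_le (B_H p m a b r) (sup_norm h).
Proof.
  intros Hm Hp Hd Hadm Hr0 Hs2 HF r Hr.
  pose proof Hadm as [_ [_ [_ [K HK]]]].
  set (E := fun x : R => exists z : C, in_disc z /\ x = Cmod (h z)).
  destruct (Lub_Rbar_correct E) as [Hub Hlub].
  change (sup_norm h) with (Lub_Rbar E).
  assert (Hfin : Rbar_le (Lub_Rbar E) K).
  { apply Hlub. intros x [z [Hz ->]]. apply HK, Hz. }
  assert (Hpos : Rbar_le 0 (Lub_Rbar E)).
  { apply Rbar_le_trans with (Finite (Cmod (h 0))); [apply Cmod_ge_0|].
    apply Hub. exists (RtoC 0). split; [unfold in_disc; rewrite Cmod_0; lra|reflexivity]. }
  destruct (Lub_Rbar E) as [S| |]; try contradiction.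
  simpl in Hpos.
  (* The bound [S + eps] is positive even if the supremum [S] is 0. *)
  assert (Hle : forall n eps, 0 < eps ->
    sum_n (fun k => (Cmod (a k) + Cmod (b k)) * r ^ (p * k + m)) n <= S + eps).
  { intros n eps Heps.
    eapply Rle_trans.
    - apply (sum_n_le_loc _ (fun k => (Cmod (a k) + Cmod (b k)) * r0 ^ (p * k + m))).
      intros k _. apply Rmult_le_compat_l.
      + apply Rplus_le_le_0_compat; apply Cmod_ge_0.
      + apply pow_incr; lra.
    - apply (partial_sum_bound p m d a b f h g); try assumption; [lra|].
      intros z Hz. specialize (Hub (Cmod (h z)) ltac:(exists z; auto)).
      simpl in Hub. lra. }
  unfold B_H. rewrite <- (Lim_seq_const S).
  apply Lim_seq_le_loc. exists 0%nat. intros n _.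
  apply le_epsilon. intros eps Heps. apply Hle, Heps.
Qed.

(** * The radius *)

Lemma Rpower_half_pow (m n : nat) :
  (1 <= m)%nat -> Rpower (1 / 2) (1 / INR m) ^ n = exp (- (INR n / INR m * ln 2)).
Proof.
  intros Hm. assert (HmR : 0 < INR m) by (apply lt_0_INR; lia).
  rewrite <- Rpower_pow by apply exp_pos. rewrite Rpower_mult. unfold Rpower.
  f_equal. replace (1 / 2) with (/ 2) by field. rewrite ln_Rinv by lra. field. lra.
Qed.

Lemma Rpower_half_root (m : nat) :
  (1 <= m)%nat ->
  0 < Rpower (1 / 2) (1 / INR m) < 1 /\ Rpower (1 / 2) (1 / INR m) ^ m = 1 / 2.
Proof.
  intros Hm. assert (HmR : 0 < INR m) by (apply lt_0_INR; lia).
  assert (Hpow : Rpower (1 / 2) (1 / INR m) ^ m = 1 / 2).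
  { rewrite Rpower_half_pow by exact Hm.
    replace (INR m / INR m * ln 2) with (ln 2) by (field; lra).
    rewrite exp_Ropp, exp_ln by lra. field. }
  assert (H0 : 0 < Rpower (1 / 2) (1 / INR m)) by apply exp_pos.
  split; [split; [exact H0|]|exact Hpow].
  apply Rnot_le_lt. intros H.
  pose proof (pow_R1_Rle _ m H). lra.
Qed.

(** With [r^m = 1 / 2] one has [s = r^p = 2^(-p/m)], so the condition on [p / m] compares [s] with
    [1 / (2 + d)], the value at which the slope of the bound at [t = 1] changes sign. *)
Lemma ratio_gt_Rlog (p m : nat) (d : R) :
  (1 <= m)%nat -> 0 <= d ->
  INR p / INR m > Rlog 2 (2 + d) -> Rpower (1 / 2) (1 / INR m) ^ p < / (2 + d).
Proof.
  intros Hm Hd H. rewrite Rpower_half_pow by exact Hm.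
  rewrite <- (exp_ln (2 + d)) by lra. rewrite <- exp_Ropp.
  apply exp_increasing. pose proof ln_lt_2 as Hl2.
  unfold Rlog in H. apply Ropp_lt_contravar.
  replace (ln (2 + d)) with (ln (2 + d) / ln 2 * ln 2) by (field; lra).
  apply Rmult_lt_compat_r; lra.
Qed.

Lemma ratio_le_Rlog (p m : nat) (d : R) :
  (1 <= m)%nat -> 0 <= d ->
  INR p / INR m <= Rlog 2 (2 + d) -> / (2 + d) <= Rpower (1 / 2) (1 / INR m) ^ p.
Proof.
  intros Hm Hd H. rewrite Rpower_half_pow by exact Hm.
  rewrite <- (exp_ln (2 + d)) by lra. rewrite <- exp_Ropp.
  pose proof ln_lt_2 as Hl2. unfold Rlog in H.
  assert (HL : INR p / INR m * ln 2 <= ln (2 + d)).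
  { replace (ln (2 + d)) with (ln (2 + d) / ln 2 * ln 2) by (field; lra).
    apply Rmult_le_compat_r; lra. }
  destruct HL as [HL|HL].
  - left. apply exp_increasing. lra.
  - rewrite HL. apply Rle_refl.
Qed.

(** The root is the supremum of the set where [F <= 0]. A negative value there would contradict
    positivity to the right, and a positive one would allow a smaller upper bound. *)
Lemma exists_last_root (F : R -> R) (x1 x2 : R) :
  (forall x, continuity_pt F x) -> F x1 <= 0 -> (forall x, x2 < x -> 0 < F x) ->
  exists x0, x1 <= x0 <= x2 /\ F x0 = 0 /\ (forall x, x0 < x -> 0 < F x).
Proof.
  intros Hc H1 H2.
  destruct (completeness (fun x => F x <= 0)) as [x0 [Hub Hlub]].
  - exists x2. intros x Hx. apply Rnot_lt_le. intros H. specialize (H2 x H). lra.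
  - exists x1. exact H1.
  - exists x0.
    assert (Hgt : forall x, x0 < x -> 0 < F x).
    { intros x Hx. apply Rnot_le_lt. intros H. specialize (Hub x H). lra. }
    assert (Hnear : F x0 <> 0 -> exists e, 0 < e /\
      forall x, Rabs (x - x0) < e -> Rabs (F x - F x0) < Rabs (F x0)).
    { intros Hne. destruct (Hc x0 (Rabs (F x0)) (Rabs_pos_lt _ Hne)) as [e [He HE]].
      exists e. split; [exact He|]. intros x Hx.
      destruct (Req_dec x x0) as [->|Hxx].
      - rewrite Rminus_diag, Rabs_R0. apply Rabs_pos_lt, Hne.
      - apply HE. split; [split; [exact I|auto]|exact Hx]. }
    repeat split.
    + apply Hub, H1.
    + apply Hlub. intros x Hx. apply Rnot_lt_le. intros H. specialize (H2 x H). lra.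
    + destruct (Rtotal_order (F x0) 0) as [Hlt|[Heq|Hlt]]; [|exact Heq|].
      * destruct Hnear as [e [He HE]]; [lra|].
        specialize (HE (x0 + e / 2)). specialize (Hgt (x0 + e / 2) ltac:(lra)).
        replace (x0 + e / 2 - x0) with (e / 2) in HE by ring.
        rewrite (Rabs_pos_eq (e / 2)) in HE by lra. specialize (HE ltac:(lra)).
        rewrite (Rabs_left (F x0)), (Rabs_pos_eq (F (x0 + e / 2) - F x0)) in HE by lra.
        lra.
      * destruct Hnear as [e [He HE]]; [lra|].
        exfalso. enough (x0 <= x0 - e / 2) by lra.
        apply Hlub. intros x Hx. apply Rnot_lt_le. intros Hxe.
        specialize (Hub x Hx). simpl in Hx.
        specialize (HE x).
        rewrite (Rabs_left1 (x - x0)) in HE by lra. specialize (HE ltac:(lra)).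
        rewrite (Rabs_pos_eq (F x0)), (Rabs_left (F x - F x0)) in HE by lra. lra.
    + exact Hgt.
Qed.

(** Completing the square in [r ^ (p - m)], using [(4 + 2 d)^2 = 4 (1 + d) (3 + d) + 4]; this is the
    shape in which [radius_bound_root] uses the equation. *)
Lemma radius_polynomial_square (p m : nat) (d r : R) :
  (m <= p)%nat ->
  r ^ (2 * (p - m)) - (8 + 4 * d) * r ^ (p - m)
    + 4 * (1 + d) * (3 + d) * r ^ (2 * p) + 4
  = (4 + 2 * d - r ^ (p - m)) ^ 2 - 4 * (1 + d) * (3 + d) * (1 - (r ^ p) ^ 2).
Proof.
  intros Hmp. rewrite <- !pow_mult, (Nat.mul_comm 2 (p - m)), (Nat.mul_comm 2 p).
  rewrite (pow_mult r (p - m) 2). ring.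
Qed.

(** For [r < 1], [r^m > 1 / 2] gives [u < 2 s], and putting [2 s] for [u] turns the polynomial into
    the square [4 ((2 + d) s - 1)^2]. For [r >= 1] the subtracted term is not positive. *)
Lemma radius_polynomial_pos (p m : nat) (d r : R) :
  (1 <= p)%nat -> (m <= p)%nat -> 0 <= d -> 0 < r -> 1 / 2 < r ^ m ->
  0 < (4 + 2 * d - r ^ (p - m)) ^ 2 - 4 * (1 + d) * (3 + d) * (1 - (r ^ p) ^ 2).
Proof.
  intros Hp Hmp Hd Hr Hrm.
  set (u := r ^ (p - m)). set (s := r ^ p).
  assert (Hsu : s = u * r ^ m).
  { unfold s, u. rewrite <- pow_add. f_equal. lia. }
  assert (Hu : 0 < u) by (apply pow_lt; exact Hr).
  assert (Hc : 0 < 4 * (1 + d) * (3 + d)) by nra.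
  destruct (Rtotal_order r 1) as [Hr1|[Hr1|Hr1]].
  - assert (Hs1 : s < 1) by (apply pow_lt_1_compat; [lra|lia]).
    assert (Hu2 : u < 2 * s) by nra.
    pose proof (pow2_ge_0 ((2 + d) * s - 1)). nra.
  - unfold u, s. rewrite Hr1, !pow1. nra.
  - assert (Hs1 : 1 < s) by (apply Rlt_pow_R1; [lra|lia]).
    pose proof (pow2_ge_0 (4 + 2 * d - u)).
    assert (0 < 4 * (1 + d) * (3 + d) * (s ^ 2 - 1)) by (apply Rmult_lt_0_compat; nra).
    lra.
Qed.

Lemma pow_le_reg (x y : R) (n : nat) :
  (1 <= n)%nat -> 0 <= y -> x ^ n <= y ^ n -> x <= y.
Proof.
  intros Hn Hy H. apply Rnot_lt_le. intros Hlt.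
  destruct n as [|n]; [lia|].
  assert (y ^ n <= x ^ n) by (apply pow_incr; lra).
  assert (0 < x ^ n) by (apply pow_lt; lra).
  simpl in H. nra.
Qed.

(** At the radius [r1] with [r1^p = 1 / (2 + d)] one has [u >= 2 s], and the comparison square
    [4 ((2 + d) s - 1)^2] is 0, so the polynomial is not positive. The last root therefore lies
    between [r1] and the radius with [r^m = 1 / 2]. *)
Lemma radius_exists (p m : nat) (d : R) :
  (1 <= m)%nat -> (m <= p)%nat -> 0 <= d ->
  / (2 + d) <= Rpower (1 / 2) (1 / INR m) ^ p ->
  exists r0, 0 < r0 <= Rpower (1 / 2) (1 / INR m) /\ / (2 + d) <= r0 ^ p /\
    radius_eqn p m d r0 /\ (forall r, r0 < r -> ~ radius_eqn p m d r).
Proof.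
  intros Hm Hmp Hd Hlog.
  destruct (Rpower_half_root m Hm) as [HR HRm].
  set (R0 := Rpower (1 / 2) (1 / INR m)) in *.
  assert (Hd2 : 0 < / (2 + d) < 1).
  { split; [apply Rinv_0_lt_compat; lra|].
    rewrite <- Rinv_1. apply Rinv_lt_contravar; lra. }
  destruct (exists_root p (/ (2 + d)) ltac:(lia) Hd2) as [r1 [Hr1 Hr1p]].
  assert (Hr1R : r1 <= R0) by (apply (pow_le_reg _ _ p); [lia|lra|lra]).
  assert (Hr1m : r1 ^ m <= 1 / 2) by (rewrite <- HRm; apply pow_incr; lra).
  set (F := fun r => r ^ (2 * (p - m)) - (8 + 4 * d) * r ^ (p - m)
    + 4 * (1 + d) * (3 + d) * r ^ (2 * p) + 4).
  destruct (exists_last_root F r1 R0) as [r0 [Hr0 [HF0 HFgt]]].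
  - intros x. apply derivable_continuous_pt. unfold F. reg.
  - unfold F. rewrite radius_polynomial_square by exact Hmp. rewrite Hr1p.
    set (u := r1 ^ (p - m)).
    assert (Hsu : / (2 + d) = u * r1 ^ m).
    { rewrite <- Hr1p. unfold u. rewrite <- pow_add. f_equal. lia. }
    assert (Hu : 0 <= u <= 1) by (apply pow_le_one; lra).
    assert (Hu2 : 2 * / (2 + d) <= u) by nra.
    assert (HD : (2 + d) * / (2 + d) = 1) by (field; lra).
    set (s := / (2 + d)) in *.
    assert ((4 + 2 * d - u) ^ 2 <= (4 + 2 * d - 2 * s) ^ 2) by (apply pow_incr; lra).
    assert (Heq : (4 + 2 * d - 2 * s) ^ 2 - 4 * (1 + d) * (3 + d) * (1 - s ^ 2)
              = 4 * ((2 + d) * s - 1) ^ 2) by ring.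
    rewrite HD in Heq. lra.
  - intros x Hx. unfold F. rewrite radius_polynomial_square by exact Hmp.
    apply radius_polynomial_pos; try assumption; try lia; try lra.
    rewrite <- HRm. apply Rnot_le_lt. intros H.
    apply pow_le_reg in H; [lra|lia|lra].
  - exists r0. repeat split.
    + lra.
    + apply Hr0.
    + rewrite <- Hr1p. apply pow_incr; lra.
    + exact HF0.
    + intros r Hr HE. specialize (HFgt r Hr). unfold radius_eqn in HE.
      fold (F r) in HE. lra.
Qed.

(** At [t = 1] the value is 1. Cancelling [1 - t] leaves [(1 + d) s (1 + t) <= 2 (1 - t s)], whose
    worst case [t = 1] is [(2 + d) s <= 1]. *)
Lemma radius_bound_log (d s t : R) :
  0 <= d -> 0 <= s <= / (2 + d) -> s <= t <= 1 ->
  1 / 2 * (2 * t + (1 + d) * (s * (1 - t ^ 2) / (1 - t * s))) <= 1.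
Proof.
  intros Hd Hs Ht.
  assert (HD : (2 + d) * s <= 1).
  { replace 1 with ((2 + d) * / (2 + d)) by (field; lra).
    apply Rmult_le_compat_l; lra. }
  assert (Hts : 0 < 1 - t * s) by nra.
  enough ((1 + d) * (s * (1 - t ^ 2) / (1 - t * s)) <= 2 * (1 - t)) by lra.
  apply (Rmult_le_reg_r (1 - t * s)); [exact Hts|].
  replace ((1 + d) * (s * (1 - t ^ 2) / (1 - t * s)) * (1 - t * s))
    with ((1 - t) * ((1 + d) * s * (1 + t))) by (field; lra).
  replace (2 * (1 - t) * (1 - t * s)) with ((1 - t) * (2 * (1 - t * s))) by ring.
  apply Rmult_le_compat_l; [lra|]. nra.
Qed.

(* In terms of [tau = 1 - t s] the bound times [s] is
   [4 + 2 d - (3 + d) tau - (1 + d) (1 - s^2) / tau]. *)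
Lemma radius_bound_root (d u s q t : R) :
  0 <= d -> 0 < s < 1 -> 0 < u <= 1 -> s = u * q -> s <= t <= 1 ->
  (4 + 2 * d - u) ^ 2 = 4 * (1 + d) * (3 + d) * (1 - s ^ 2) ->
  q * (2 * t + (1 + d) * (s * (1 - t ^ 2) / (1 - t * s))) <= 1.
Proof.
  intros Hd Hs Hu Hsq Ht HF.
  set (tau := 1 - t * s).
  assert (Htau : 0 < tau) by (unfold tau; nra).
  set (X := 1 - s ^ 2) in *.
  (* The inequality between the means, [4 x y <= (x + y)^2]; the radius equation identifies [4 x y]
     with [(4 + 2 d - u)^2]. *)
  assert (Hw : 4 + 2 * d - u <= (3 + d) * tau + (1 + d) * (X / tau)).
  { assert (HX : 0 < X) by (unfold X; nra).
    assert (HXt : 0 < X / tau) by (apply Rdiv_lt_0_compat; assumption).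
    apply le_of_sqr_le; [nra|]. rewrite HF.
    replace (4 * (1 + d) * (3 + d) * X)
      with (4 * ((3 + d) * tau) * ((1 + d) * (X / tau))) by (field; lra).
    pose proof (pow2_ge_0 ((3 + d) * tau - (1 + d) * (X / tau))). nra. }
  apply (Rmult_le_reg_l u); [lra|].
  replace (u * (q * (2 * t + (1 + d) * (s * (1 - t ^ 2) / tau))))
    with (4 + 2 * d - ((3 + d) * tau + (1 + d) * (X / tau))).
  - lra.
  - rewrite <- Rmult_assoc, <- Hsq. unfold X. unfold tau in *. field. lra.
Qed.

(** * Extremal functions *)

Lemma rotation_admissible (p m : nat) (lam : C) (a : nat -> C) (h : C -> C) :
  (1 <= m)%nat -> (1 <= p)%nat -> Cmod lam = 1 -> has_expansion p m a h ->
  (forall z, in_disc z -> Cmod (h z) <= 1) ->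
  admissible p m 1 a (fun k => (lam * a k)%C)
    (fun z => (h z + Cconj (lam * h z))%C) h (fun z => (lam * h z)%C).
Proof.
  intros Hm Hp Hlam Ha Hb.
  pose proof (has_expansion_scal p m lam a h Ha) as Hg.
  destruct m as [|m]; [lia|].
  split; [|split; [|split]].
  - split; [reflexivity|].
    split; [exact (has_expansion_analytic p m a h Hp Ha)|].
    split; [exact (has_expansion_analytic p m _ _ Hp Hg)|].
    split; assumption.
  - apply (C_derive_n_leading p (S m) _ _ _ _ Hp Ha Hg).
    rewrite Cmod_mult, Hlam. ring.
  - intros z Hz _. rewrite Rmult_1_l.
    replace (C_derive (fun z => lam * h z)%C z) with (lam * C_derive h z)%C.
    { rewrite Cmod_mult, Hlam. lra. }
    (* Both derivatives are sums of the same termwise differentiated series, so uniqueness of the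
       sum identifies them. *)
    assert (E : forall k, (INR (p * k + S m) * (lam * a k)
                           = lam * (INR (p * k + S m) * a k))%C) by (intros k; ring).
    exact (is_series_C_unique _ _ _
      (has_expansion_scal _ _ lam _ _ (has_expansion_C_derive p m a h Hp Ha) z Hz)
      (has_expansion_ext _ _ _ _ _ E (has_expansion_C_derive p m _ _ Hp Hg) z Hz)).
  - exists 1. exact Hb.
Qed.

Lemma rotation_extremal (p m : nat) (lam : C) (a : nat -> C) (h : C -> C) (R0 : R) :
  (1 <= m)%nat -> (1 <= p)%nat -> Cmod lam = 1 -> has_expansion p m a h ->
  (forall z, in_disc z -> Cmod (h z) <= 1) -> 0 < R0 ->
  is_series (fun k => 2 * Cmod (a k) * R0 ^ (p * k + m)) 1 ->
  (forall (a b : nat -> C) (f h g : C -> C),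
     admissible p m 1 a b f h g -> Rbar_le (B_H p m a b R0) (sup_norm h)) ->
  extremal p m 1 (fun z => (h z + Cconj (lam * h z))%C) h (fun z => (lam * h z)%C) R0.
Proof.
  intros Hm Hp Hlam Ha Hb HR0 Hser Hle.
  pose proof (rotation_admissible p m lam a h Hm Hp Hlam Ha Hb) as Hadm.
  exists a, (fun k => (lam * a k)%C).
  assert (Hterm : forall r, B_H p m a (fun k => (lam * a k)%C) r
    = Lim_seq (sum_n (fun k => 2 * Cmod (a k) * r ^ (p * k + m)))).
  { intros r. unfold B_H. apply Lim_seq_ext. intros n. apply sum_n_Rext.
    intros k. rewrite Cmod_mult, Hlam. ring. }
  assert (H1 : B_H p m a (fun k => (lam * a k)%C) R0 = 1).
  { rewrite Hterm. apply is_lim_seq_unique. exact Hser. }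
  (* the upper bound proved for the class gives [1 <= sup_norm h] *)
  assert (Hsup : sup_norm h = 1).
  { apply Rbar_le_antisym.
    - apply Lub_Rbar_correct. intros x [z [Hz ->]]. apply Hb, Hz.
    - rewrite <- H1. exact (Hle _ _ _ _ _ Hadm). }
  split; [exact Hadm|]. split; [rewrite H1, Hsup; reflexivity|].
  intros r Hr _. rewrite Hsup, Hterm.
  assert (Hq : 1 < r / R0).
  { apply (Rmult_lt_reg_r R0); [exact HR0|]. field_simplify; lra. }
  (* All exponents are at least [m], so the step from [R0] to [r] multiplies each partial sum by at
     least [(r / R0) ^ m > 1]; the comparison of limits also covers divergence. *)
  apply Rbar_lt_le_trans with (Finite ((r / R0) ^ m)).
  { simpl. apply Rlt_pow_R1; [exact Hq|lia]. }
  replace (Finite ((r / R0) ^ m))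
    with (Lim_seq (fun n => (r / R0) ^ m *
            sum_n (fun k => 2 * Cmod (a k) * R0 ^ (p * k + m)) n)).
  2:{ rewrite Lim_seq_scal_l. rewrite (is_lim_seq_unique (sum_n (fun k => 2 * Cmod (a k) * R0 ^ (p * k + m))) 1 Hser).
      simpl. f_equal. ring. }
  apply Lim_seq_le_loc. exists 0%nat. intros n _.
  rewrite <- sum_n_scal. apply sum_n_le_loc. intros k _.
  replace (r ^ (p * k + m)) with ((r / R0) ^ (p * k + m) * R0 ^ (p * k + m)).
  2:{ rewrite <- Rpow_mult_distr. f_equal. field. lra. }
  replace ((r / R0) ^ m * (2 * Cmod (a k) * R0 ^ (p * k + m)))
    with (2 * Cmod (a k) * ((r / R0) ^ m * R0 ^ (p * k + m))) by ring.
  apply Rmult_le_compat_l; [pose proof (Cmod_ge_0 (a k)); lra|].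
  apply Rmult_le_compat_r; [apply pow_le; lra|].
  apply Rle_pow; [lra|lia].
Qed.

Lemma monomial_majorant_series (p m : nat) (r : R) :
  r ^ m = 1 / 2 -> is_series (fun k => 2 * Cmod (unit_seq k) * r ^ (p * k + m)) 1.
Proof.
  intros Hr.
  enough (H : is_lim_seq (sum_n (fun k => 2 * Cmod (unit_seq k) * r ^ (p * k + m))) 1)
    by exact H.
  apply (is_lim_seq_ext (fun _ => 1)); [|apply is_lim_seq_const].
  intros n. induction n as [|n IH].
  - rewrite sum_O, Nat.mul_0_r, Nat.add_0_l, Hr. simpl unit_seq. rewrite Cmod_1.
    field.
  - rewrite sum_n_S, <- IH. simpl unit_seq. rewrite Cmod_0. ring.
Qed.

(** Taylor coefficients of [(w - al) / (1 - al w)] in [w]. *)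
Definition blaschke_seq (al : R) (k : nat) : C :=
  match k with
  | O => RtoC (- al)
  | S j => RtoC ((1 - al ^ 2) * al ^ j)
  end.

Lemma blaschke_denominator_neq_0 (al : R) (w : C) :
  0 <= al <= 1 -> Cmod w < 1 -> (1 - al * w)%C <> 0.
Proof.
  intros Hal Hw E.
  assert (Ew : Cmod (al * w) = 1).
  { replace (al * w)%C with (1 - (1 - al * w))%C by ring. rewrite E.
    replace (1 - 0)%C with (RtoC 1) by ring. apply Cmod_1. }
  rewrite Cmod_mult, Cmod_R, Rabs_pos_eq in Ew by lra.
  pose proof (Cmod_ge_0 w). nra.
Qed.

(** The partial sums have a closed form whose error contains [w ^ (n + 1)]. The decay comes from
    [Cmod w < 1], so [al = 1] is included. *)
Lemma has_expansion_blaschke (p m : nat) (al : R) :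
  (1 <= p)%nat -> 0 <= al <= 1 ->
  has_expansion p m (blaschke_seq al)
    (fun z => (z ^ m * ((z ^ p - al) / (1 - al * z ^ p)))%C).
Proof.
  intros Hp Hal z Hz. unfold in_disc in Hz.
  pose proof (Cmod_ge_0 z) as Hz0.
  set (w := (z ^ p)%C).
  assert (Hw : Cmod w < 1).
  { unfold w. rewrite Cmod_pow. apply pow_lt_1_compat; [lra|lia]. }
  pose proof (Cmod_ge_0 w) as Hw0.
  pose proof (blaschke_denominator_neq_0 al w Hal Hw) as Hne.
  assert (Hsum : forall n,
    sum_n (fun k => blaschke_seq al k * z ^ (p * k + m))%C n
     = (z ^ m * ((w - al) / (1 - al * w))
        - z ^ m * (RtoC ((1 - al ^ 2) * al ^ n) * w ^ S n / (1 - al * w)))%C :> C).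
  { assert (Hpow : forall k, (z ^ (p * k + m) = w ^ k * z ^ m)%C).
    { intros k. unfold w. rewrite Cpow_add_r, Cpow_mult_r. reflexivity. }
    induction n as [|n IH].
    - rewrite sum_O, Hpow. simpl.
      rewrite !RtoC_mult, RtoC_minus, RtoC_opp, !RtoC_mult.
      match goal with |- @eq _ ?x ?y => change (@eq C x y) end. field. exact Hne.
    - rewrite sum_n_CS, IH, Hpow.
      change (blaschke_seq al (S n)) with (RtoC ((1 - al ^ 2) * al ^ n)).
      change (al ^ S n) with (al * al ^ n). rewrite !RtoC_mult, !Cpow_S.
      generalize (RtoC (1 - al ^ 2)) (RtoC (al ^ n)) (w ^ n)%C (z ^ m)%C.
      intros B A W Z. field. exact Hne. }
  apply is_series_C_iff. intros eps Heps.
  set (K := / Cmod (1 - al * w)).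
  assert (HK : 0 < K) by (apply Rinv_0_lt_compat, Cmod_gt_0; exact Hne).
  assert (Hlim : is_lim_seq (fun n => Cmod w ^ n) 0).
  { apply is_lim_seq_geom. rewrite Rabs_pos_eq; lra. }
  apply is_lim_seq_spec in Hlim.
  destruct (Hlim (mkposreal (eps / K) (Rdiv_lt_0_compat _ _ Heps HK))) as [N HN].
  exists N. intros n Hn. specialize (HN n Hn). simpl in HN.
  rewrite Rminus_0_r, Rabs_pos_eq in HN by (apply pow_le; exact Hw0).
  rewrite Hsum.
  match goal with |- Cmod ?x < _ => replace x with
    (- (z ^ m * (RtoC ((1 - al ^ 2) * al ^ n) * w ^ S n / (1 - al * w))))%C
    by (unfold w; ring) end.
  rewrite Cmod_opp. unfold Cdiv.
  rewrite !Cmod_mult, Cmod_inv by exact Hne. fold K. rewrite !Cmod_pow, Cmod_R.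
  assert (Hal2 : 0 <= (1 - al ^ 2) * al ^ n <= 1).
  { pose proof (pow_le_one al n Hal). pose proof (pow_le_one al 2 Hal).
    set (X := al ^ 2) in *. set (Y := al ^ n) in *. split; nra. }
  rewrite Rabs_pos_eq by lra.
  pose proof (pow_le_one (Cmod z) m ltac:(lra)) as Hzm.
  assert (Hwn : 0 <= Cmod w ^ n) by (apply pow_le; exact Hw0).
  apply Rle_lt_trans with (Cmod w ^ n * K).
  - rewrite <- (Rmult_1_l (Cmod w ^ n * K)).
    apply Rmult_le_compat; [lra| |lra|].
    + apply Rmult_le_pos; [|lra]. apply Rmult_le_pos; [lra|apply pow_le; exact Hw0].
    + apply Rmult_le_compat_r; [lra|]. rewrite <- (Rmult_1_l (Cmod w ^ n)).
      apply Rmult_le_compat; [lra|apply pow_le; exact Hw0|lra|]. simpl. nra.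
  - replace eps with (eps / K * K) by (field; lra).
    apply Rmult_lt_compat_r; assumption.
Qed.

(** Rests on [|1 - al w|^2 - |w - al|^2 = (1 - al^2) (1 - |w|^2)] with [w = z ^ p]. *)
Lemma blaschke_le_1 (p m : nat) (al : R) (z : C) :
  (1 <= p)%nat -> 0 <= al <= 1 -> in_disc z ->
  Cmod (z ^ m * ((z ^ p - al) / (1 - al * z ^ p))) <= 1.
Proof.
  intros Hp Hal Hz. unfold in_disc in Hz.
  pose proof (Cmod_ge_0 z) as Hz0.
  set (w := (z ^ p)%C).
  assert (Hw : Cmod w < 1).
  { unfold w. rewrite Cmod_pow. apply pow_lt_1_compat; [lra|lia]. }
  pose proof (Cmod_ge_0 w) as Hw0.
  pose proof (blaschke_denominator_neq_0 al w Hal Hw) as Hne.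
  assert (Hpos : 0 < Cmod (1 - al * w)) by (apply Cmod_gt_0; exact Hne).
  assert (Hle : Cmod (w - al) <= Cmod (1 - al * w)).
  { apply le_of_sqr_le; [lra|].
    assert (Hw2 : Cmod w ^ 2 <= 1) by nra.
    rewrite Cmod2_alt in Hw2. rewrite !Cmod2_alt.
    destruct w as [x y]. simpl in *.
    assert (0 <= (1 - al * al) * (1 - (x * (x * 1) + y * (y * 1))))
      by (apply Rmult_le_pos; nra).
    nra. }
  rewrite Cmod_mult, Cmod_div by exact Hne.
  rewrite Cmod_pow.
  pose proof (pow_le_one (Cmod z) m ltac:(lra)) as Hzm.
  assert (Hq : 0 <= Cmod (w - al) / Cmod (1 - al * w) <= 1).
  { split; [apply Rdiv_le_0_compat; [apply Cmod_ge_0|exact Hpos]|].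
    apply (Rmult_le_reg_r (Cmod (1 - al * w))); [exact Hpos|].
    unfold Rdiv. rewrite Rmult_assoc, Rinv_l; lra. }
  nra.
Qed.

Lemma blaschke_majorant_series (p m : nat) (al r : R) :
  0 <= al <= 1 -> 0 <= r -> al * r ^ p < 1 ->
  is_series (fun k => 2 * Cmod (blaschke_seq al k) * r ^ (p * k + m))
    (2 * r ^ m * (al + (1 - al ^ 2) * r ^ p / (1 - al * r ^ p))).
Proof.
  intros Hal Hr Hlt.
  set (s := r ^ p) in *.
  assert (Hs : 0 <= s) by (apply pow_le; exact Hr).
  assert (Hpow : forall k, r ^ (p * k + m) = s ^ k * r ^ m)
    by (intros k; unfold s; rewrite pow_add, pow_mult; reflexivity).
  pose proof (is_series_scal_r (2 * r ^ m * (1 - al ^ 2) * s) _ _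
    (is_series_geom (al * s) ltac:(rewrite Rabs_pos_eq; nra))) as HG.
  apply is_series_decr_1.
  match goal with |- is_series _ ?l => replace l with
    (/ (1 - al * s) * (2 * r ^ m * (1 - al ^ 2) * s)) end.
  - revert HG. apply is_series_ext. intros k. simpl blaschke_seq.
    rewrite Cmod_R, Rabs_pos_eq, Hpow, Rpow_mult_distr.
    + simpl. R_ring.
    + apply Rmult_le_pos; [nra|apply pow_le; lra].
  - rewrite Nat.mul_0_r, Nat.add_0_l. simpl blaschke_seq.
    rewrite Cmod_R, Rabs_left1 by lra.
    change (/ (1 - al * s) * (2 * r ^ m * (1 - al ^ 2) * s)
      = 2 * r ^ m * (al + (1 - al ^ 2) * s / (1 - al * s))
        + - (2 * - - al * r ^ m)).
    field. lra.
Qed.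

(** For [d = 1] the two terms [4 tau] and [2 (1 - s^2) / tau] of [radius_bound_root] are equal at
    [tau = sqrt ((1 - s^2) / 2)], and [al = (1 - tau) / s] is the corresponding [t]. At this point
    the bound equals 1 exactly. *)
Lemma extremal_a_spec (p : nat) (u q r : R) :
  0 < r -> 1 / 3 <= r ^ p < 1 -> 0 < u <= 1 -> r ^ p = u * q ->
  (6 - u) ^ 2 = 32 * (1 - (r ^ p) ^ 2) ->
  let al := extremal_a p r in
  0 <= al <= 1 /\ al * r ^ p < 1 /\
  2 * q * (al + (1 - al ^ 2) * r ^ p / (1 - al * r ^ p)) = 1.
Proof.
  intros Hr Hs Hu Hsu HF al. unfold al, extremal_a.
  rewrite Nat.mul_comm, pow_mult.
  set (s := r ^ p) in *.
  set (tau := sqrt (1 - s ^ 2) / sqrt 2).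
  assert (HX : 0 < 1 - s ^ 2) by nra.
  assert (H2 : 0 < sqrt 2) by (apply sqrt_lt_R0; lra).
  assert (Htau : 0 < tau) by (apply Rdiv_lt_0_compat; [apply sqrt_lt_R0|]; assumption).
  assert (Htau2 : tau ^ 2 = (1 - s ^ 2) / 2).
  { unfold tau, Rdiv. rewrite Rpow_mult_distr, pow_inv, !pow2_sqrt by lra. reflexivity. }
  assert (H8 : 6 - u = 8 * tau).
  { apply Rle_antisym; apply le_of_sqr_le; try lra; rewrite HF, Rpow_mult_distr, Htau2; lra. }
  set (x := (1 - tau) * (1 / s)).
  assert (Hxs : x * s = 1 - tau) by (unfold x; field; lra).
  assert (Ht1 : tau <= 1) by (apply le_of_sqr_le; [lra|]; rewrite Htau2; nra).
  (* This yields [al <= 1]. Squared, it reads [2 (1 - s) <= 1 + s], that is [s >= 1 / 3], the value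
     of [1 / (2 + d)] at [d = 1]. *)
  assert (Hts : 1 - s <= tau) by (apply le_of_sqr_le; [lra|]; rewrite Htau2; nra).
  split; [split|split].
  - apply Rmult_le_pos; [lra|]. apply Rdiv_le_0_compat; lra.
  - apply (Rmult_le_reg_r s); lra.
  - lra.
  - rewrite Hxs. replace (1 - (1 - tau)) with tau by ring.
    apply (Rmult_eq_reg_l (u * s * tau)).
    2:{ apply Rgt_not_eq, Rmult_lt_0_compat; [apply Rmult_lt_0_compat; lra|exact Htau]. }
    replace (u * s * tau * (2 * q * (x + (1 - x ^ 2) * s / tau)))
      with (2 * (u * q) * ((x * s) * tau + s ^ 2 - (x * s) ^ 2)) by (field; lra).
    rewrite <- Hsu, Hxs.
    replace (s ^ 2) with (1 - 2 * tau ^ 2) by lra.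
    replace u with (6 - 8 * tau) by lra. ring.
Qed.

Theorem theorem1 :
  forall (m p : nat) (d : R),
    (1 <= m)%nat -> (2 <= p)%nat -> 0 <= d <= 1 ->
    (INR p / INR m > Rlog 2 (2 + d) ->
       (forall (a b : nat -> C) (f h g : C -> C),
          admissible p m d a b f h g ->
          forall r : R, 0 <= r <= Rpower (1 / 2) (1 / INR m) ->
            Rbar_le (B_H p m a b r) (sup_norm h)) /\
       (d = 1 ->
          forall lam : C, Cmod lam = 1 ->
            let h := fun z : C => (z ^ m)%C in
            let g := fun z : C => (lam * h z)%C in
            let f := fun z : C => (h z + Cconj (lam * h z))%C in
            extremal p m d f h g (Rpower (1 / 2) (1 / INR m)))) /\
    (1 <= INR p / INR m <= Rlog 2 (2 + d) ->
       exists r0 : R, is_max_pos_root p m d r0 /\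
         (forall (a b : nat -> C) (f h g : C -> C),
            admissible p m d a b f h g ->
            forall r : R, 0 <= r <= r0 ->
              Rbar_le (B_H p m a b r) (sup_norm h)) /\
         (d = 1 ->
            forall lam : C, Cmod lam = 1 ->
              let al := RtoC (extremal_a p r0) in
              let h := fun z : C =>
                (z ^ m * ((z ^ p - al) / (1 - al * z ^ p)))%C in
              let g := fun z : C => (lam * h z)%C in
              let f := fun z : C => (h z + Cconj (lam * h z))%C in
              extremal p m d f h g r0)).
Proof.
  intros m p d Hm Hp Hd.
  destruct (Rpower_half_root m Hm) as [HR HRm].
  split.
  - intros Hlog.
    pose proof (ratio_gt_Rlog p m d Hm (proj1 Hd) Hlog) as Hs.
    set (R0 := Rpower (1 / 2) (1 / INR m)) in *.
    assert (Hs0 : 0 < R0 ^ p) by (apply pow_lt; lra).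
    (* Gives [R0 ^ p < 1 / 2], from which the condition on the square of [R0 ^ p] follows. *)
    assert (Hhalf : / (2 + d) <= / 2) by (apply Rinv_le_contravar; lra).
    assert (Hle : forall (a b : nat -> C) (f h g : C -> C),
      admissible p m d a b f h g -> forall r, 0 <= r <= R0 ->
      Rbar_le (B_H p m a b r) (sup_norm h)).
    { intros a b f h g Hadm.
      apply (B_H_le_sup_norm p m d a b f h g R0); try assumption; try lia.
      - nra.
      - intros t Ht. rewrite HRm. apply radius_bound_log; lra. }
    split; [exact Hle|].
    intros -> lam Hlam h g f.
    apply (rotation_extremal p m lam unit_seq h R0); try assumption; try lia; try lra.
    + apply has_expansion_pow.
    + intros z Hz. unfold h. rewrite Cmod_pow. apply pow_le_one.
      unfold in_disc in Hz. pose proof (Cmod_ge_0 z). lra.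
    + apply monomial_majorant_series, HRm.
    + intros a b f' h' g' Hadm. apply (Hle a b f' h' g' Hadm). lra.
  - intros [Hpm Hlog].
    assert (HmR : 0 < INR m) by (apply lt_0_INR; lia).
    assert (Hmp : (m <= p)%nat).
    { apply INR_le. apply (Rmult_le_compat_r (INR m)) in Hpm; [|lra].
      replace (INR p / INR m * INR m) with (INR p) in Hpm by (field; lra). lra. }
    pose proof (ratio_le_Rlog p m d Hm (proj1 Hd) Hlog) as Hs.
    destruct (radius_exists p m d Hm Hmp (proj1 Hd) Hs) as [r0 [Hr0 [Hs0 [HE Hmax]]]].
    assert (Hr1 : 0 < r0 < 1) by lra.
    assert (Hr0m : r0 ^ m <= 1 / 2) by (rewrite <- HRm; apply pow_incr; lra).
    assert (Hr0p : r0 ^ p <= 1 / 2).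
    { eapply Rle_trans; [|exact Hr0m]. apply pow_anti; [lra|exact Hmp]. }
    assert (Hp0 : 0 < r0 ^ p) by (apply pow_lt; lra).
    assert (Hu : 0 < r0 ^ (p - m) <= 1).
    { split; [apply pow_lt; lra|apply pow_le_one; lra]. }
    assert (Hsu : r0 ^ p = r0 ^ (p - m) * r0 ^ m).
    { rewrite <- pow_add. f_equal. lia. }
    assert (HF : (4 + 2 * d - r0 ^ (p - m)) ^ 2
                 = 4 * (1 + d) * (3 + d) * (1 - (r0 ^ p) ^ 2)).
    { unfold radius_eqn in HE. rewrite radius_polynomial_square in HE by exact Hmp. lra. }
    exists r0.
    assert (Hle : forall (a b : nat -> C) (f h g : C -> C),
      admissible p m d a b f h g -> forall r, 0 <= r <= r0 ->
      Rbar_le (B_H p m a b r) (sup_norm h)).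
    { intros a b f h g Hadm.
      apply (B_H_le_sup_norm p m d a b f h g r0); try assumption; try lia.
      - nra.
      - intros t Ht. apply (radius_bound_root d (r0 ^ (p - m))); try assumption; lra. }
    split; [|split; [exact Hle|]].
    + split; [lra|]. split; [exact HE|].
      intros r _ Hr. apply Rnot_lt_le. intros Hlt. exact (Hmax r Hlt Hr).
    + intros -> lam Hlam al h g f.
      destruct (extremal_a_spec p (r0 ^ (p - m)) (r0 ^ m) r0) as [Hal [Hals Hval]];
        try assumption; try lra.
      apply (rotation_extremal p m lam (blaschke_seq (extremal_a p r0)) h r0);
        try assumption; try lia; try lra.
      * apply has_expansion_blaschke; [lia|exact Hal].
      * intros z Hz. apply blaschke_le_1; [lia|exact Hal|exact Hz].
      * rewrite <- Hval. apply blaschke_majorant_series; lra.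
      * intros a b f' h' g' Hadm. apply (Hle a b f' h' g' Hadm). lra.
Qed.
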